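(* Let $R$ be an indecomposable commutative ring and let $\Gamma$ be a discrete group with identity $\epsilon$. Let $(\Sigma,i,q)$ with gradings $c_\Sigma:\Sigma\to\Gamma$, $c_G:G\to\Gamma$ be a $\Gamma$-graded discrete $R$-twist over an ample Hausdorff groupoid $G$. Let $A=A_R^{\mathrm{gr}}(G;\Sigma)$ be the associated graded twisted Steinberg algebra and $C=A_R(G^{(0)};q^{-1}(G^{(0)}))$. Write $G_\epsilon=c_G^{-1}(\epsilon)$ and $\Sigma_\epsilon=c_\Sigma^{-1}(\epsilon)$. (1) If $G_\epsilon$ is effective, then $(A,C)$ is a graded algebraic Cartan pair. (2) If $G_\epsilon$ is principal, then $(A,C)$ is a graded algebraic diagonal pair. (3) $(A,C)$ is a graded algebraic quasi-Cartan pair if and only if the twist $\Sigma_\epsilon$ over $G_\epsilon$ satisfies the local bisection hypothesis.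
   Context: **Groupoids.** $s(\alpha)=\alpha^{-1}\alpha$, $r(\alpha)=\alpha\alpha^{-1}$. An open bisection of a topological groupoid is an open set $B$ with $r(B),s(B)$ open and $r|_B,s|_B$ homeomorphisms onto their images. A topological groupoid is ample if it has a basis of compact open bisections. $\mathrm{Iso}(G)=\{\alpha:r(\alpha)=s(\alpha)\}$; $G$ is principal if $\mathrm{Iso}(G)=G^{(0)}$ and effective if the interior of $\mathrm{Iso}(G)$ is $G^{(0)}$. A ring is indecomposable if its only idempotents are $0,1$. **Discrete $R$-twists.** A discrete $R$-twist over an ample groupoid $G$ is a sequence $G^{(0)}\times R^\times\xrightarrow{i}\Sigma\xrightarrow{q}G$, where $R^\times$ is the (discrete) unit group, $G^{(0)}\times R^\times$ is the trivial group bundle, $\Sigma$ is a topological groupoid with $\Sigma^{(0)}=i(G^{(0)}\times\{1\})$, and $i,q$ are continuous groupoid homomorphisms restricting to homeomorphisms of unit spaces, such that: (DT1) $i(\{x\}\times R^\times)=q^{-1}(x)$ for $x\in G^{(0)}$, $i$ is injective and $q$ is surjective; (DT2) each $\alpha\in G$ has an open bisection $B_\alpha\ni\alpha$ and a continuous $P_\alpha:B_\alpha\to\Sigma$ with $q\circ P_\alpha=\mathrm{id}$ and $(\beta,t)\mapsto i(r(\beta),t)P_\alpha(\beta)$ a homeomorphism $B_\alpha\times R^\times\to q^{-1}(B_\alpha)$; (DT3) $i(r(\sigma),t)\sigma=\sigma i(s(\sigma),t)$ for all $\sigma,t$. Write $t\cdot\sigma=i(r(\sigma),t)\sigma$ and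 identify $\Sigma^{(0)}$ with $G^{(0)}$. It is $\Gamma$-graded if equipped with continuous groupoid homomorphisms $c_\Sigma:\Sigma\to\Gamma$ and $c_G:G\to\Gamma$ with $c_\Sigma=c_G\circ q$. Restricting $i$ and $q$ gives a discrete $R$-twist $G^{(0)}\times R^\times\to\Sigma_\epsilon\to G_\epsilon$ over $G_\epsilon$ (note $G_\epsilon^{(0)}=G^{(0)}$). **Twisted Steinberg algebras.** For Hausdorff ample $G$, $A_R(G;\Sigma)$ is the set of locally constant $f:\Sigma\to R$ with $f(t\cdot\sigma)=t^{-1}f(\sigma)$ for all $t\in R^\times,\sigma\in\Sigma$ and $\mathrm{supp}_G(f):=q(\mathrm{supp}(f))$ compact, where $\mathrm{supp}(f)=\{\sigma: f(\sigma)\ne 0\}$. Linear operations are pointwise and $(f*g)(\sigma)=\sum_{\alpha\in\mathrm{supp}_G(f),\,r(\alpha)=r(\sigma)}f(S(\alpha))g(S(\alpha)^{-1}\sigma)$ for any section $S:\mathrm{supp}_G(f)\to\mathrm{supp}(f)$ of $q$ (independent of $S$). $A_R^{\mathrm{gr}}(G;\Sigma)$ is $A_R(G;\Sigma)$ with the $\Gamma$-grading whose $\gamma$-component is $\{f:\mathrm{supp}_G(f)\subseteq c_G^{-1}(\gamma)\}$. $A_R(G^{(0)};q^{-1}(G^{(0)}))$ is regarded, via extension by zero, as the subalgebra of $f$ with $\mathrm{supp}_G(f)\subseteq G^{(0)}$; it lies in the $\epsilon$-component. **Normalisers.** For a commutative subalgebra $C$ of an $R$-algebra $B$, $I(C)$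 is the set of idempotents of $C$. $n\in B$ is a normaliser of $C$ in $B$ if there is $m\in B$ with $mnm=m$, $nmn=n$, $mCn\cup nCm\subseteq C$; $N_B(C)$ is the set of these. $I(C)$ is a set of local units for $B$ if for each finite $F\subseteq B$ some $e\in I(C)$ satisfies $ea=a=ae$ for all $a\in F$; then $m$ is unique, written $n^\dagger$. A normaliser $n$ is free if $n\in C$ or $(n^\dagger n)(nn^\dagger)=0$ (equivalently $n^2=0$). (WT): if $e\in I(C)\setminus\{0\}$, $t\in R$, $te=0$, then $t=0$. **Local bisection hypothesis.** A discrete $R$-twist $\Sigma\to G$ over an ample Hausdorff groupoid satisfies it if for every normaliser $n$ of $A_R(G^{(0)};q^{-1}(G^{(0)}))$ in $A_R(G;\Sigma)$, $\mathrm{supp}_G(n)$ is an open bisection of $G$. **Algebraic pairs.** Let $C\subseteq B$ be a commutative subalgebra satisfying (WT). A conditional expectation $P:B\to C$ is an $R$-linear map with $P|_C=\mathrm{id}_C$, $P(cbc')=cP(b)c'$; it is faithful if for each $b\ne0$ there is $n\in N_B(C)$ with $P(nb)\neq0$; it is implemented by idempotents if for each $n\in N_B(C)$ there is $e\in I(C)$ with $P(n)=ne=en$. Suppose (i) $I(C)$ is a set of local units for $B$; (ii) $C=\mathrm{span}_R I(C)$; (iii) $B=\mathrm{span}_R N_B(C)$; (iv) there is a faithful conditional expectation $B\to C$. Then $(B,C)$ is an algebraic diagonal pair if $B$ is spanned by the free normalisers of $C$; an algebraic Cartan pair if $C$ is a maximal commutative subalgebra of $B$; an algebraic quasi-Cartan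 pair if there is a faithful conditional expectation $B\to C$ implemented by idempotents. **Graded pairs.** For a $\Gamma$-graded $R$-algebra $A$ and a commutative subalgebra $C\subseteq A_\epsilon$, $(A,C)$ is a graded algebraic diagonal (resp. Cartan, quasi-Cartan) pair if $(A_\epsilon,C)$ is an algebraic diagonal (resp. Cartan, quasi-Cartan) pair and $A$ is spanned by the homogeneous normalisers $N_\star(C)=\bigcup_\gamma(N_A(C)\cap A_\gamma)$. *)

(* Defs.v *)
From HB Require Import structures.
From mathcomp Require Import all_boot all_order all_algebra.
From mathcomp Require Import all_classical all_reals topology.

Set Implicit Arguments.
Unset Strict Implicit.
Unset Printing Implicit Defensive.

Import GRing.Theory.
Local Open Scope classical_set_scope.
Local Open Scope ring_scope.

Definition indecomposable (R : pzRingType) : Prop :=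
  forall e : R, e * e = e -> e = 0 \/ e = 1.

(* The inverse of a homeomorphism is continuous exactly when relatively open
   subsets of A have relatively open images in B. *)
Definition homeo_onto (X Y : topologicalType) (A : set X) (B : set Y)
    (f : X -> Y) : Prop :=
  [/\ set_bij A B f,
      {within A, continuous f} &
      forall U : set X, open U ->
        exists2 V : set Y, open V & f @` (A `&` U) = B `&` V].

Definition locally_constant (X : topologicalType) (Y : Type) (f : X -> Y) :
  Prop := forall x : X, \forall y \near x, f y = f x.

Definition units (R : comUnitRingType) : Type := {t : R | t \is a GRing.unit}.

Section UnitGroup.
Variable R : comUnitRingType.

HB.instance Definition _ := Choice.on (units R).

Definition unit1 : units R := exist _ 1 (unitr1 R).

Definition unit_mul (s t : units R) : units R :=
  exist _ (val s * val t)
    (etrans (unitrMr (val t) (valP s)) (valP t)).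

Definition unit_inv (t : units R) : units R :=
  exist _ (val t)^-1 (etrans (unitrV (val t)) (valP t)).

Lemma unit_mulA : associative unit_mul.
Proof. by move=> s t u; apply: val_inj; rewrite /= mulrA. Qed.

Lemma unit_mul1 : left_id unit1 unit_mul.
Proof. by move=> t; apply: val_inj; rewrite /= mul1r. Qed.

Lemma unit_mulr1 : right_id unit1 unit_mul.
Proof. by move=> t; apply: val_inj; rewrite /= mulr1. Qed.

Lemma unit_mulV : left_inverse unit1 unit_inv unit_mul.
Proof. by move=> t; apply: val_inj; rewrite /= mulVr // (valP t). Qed.

Lemma unit_mulrV : right_inverse unit1 unit_inv unit_mul.
Proof. by move=> t; apply: val_inj; rewrite /= mulrV // (valP t). Qed.

HB.instance Definition _ := isGroup.Build (units R)
  unit_mulA unit_mul1 unit_mulr1 unit_mulV unit_mulrV.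

End UnitGroup.

(* The product of a groupoid is a total function whose value at (a, b) matters
   only if s(a) = r(b). *)
Section Arrows.
Variables (T : Type) (mul : T -> T -> T) (inv : T -> T).

Definition arrow_src a := mul (inv a) a.
Definition arrow_rng a := mul a (inv a).
Definition arrow_comp a b : Prop := arrow_src a = arrow_rng b.

Record is_groupoid : Prop := IsGroupoid {
  gpd_invK : involutive inv;
  gpd_mul_src : forall a b, arrow_comp a b -> arrow_src (mul a b) = arrow_src b;
  gpd_mul_rng : forall a b, arrow_comp a b -> arrow_rng (mul a b) = arrow_rng a;
  gpd_mulA : forall a b c, arrow_comp a b -> arrow_comp b c ->
    mul (mul a b) c = mul a (mul b c);
  gpd_rng_mul : forall a, mul (arrow_rng a) a = a;
  gpd_mul_srcr : forall a, mul a (arrow_src a) = a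
}.

End Arrows.

Record topGroupoid := TopGroupoid {
  gpd_space :> topologicalType;
  gmul : gpd_space -> gpd_space -> gpd_space;
  ginv : gpd_space -> gpd_space;
  gpdP : is_groupoid gmul ginv;
  gmul_continuous : {within [set p | arrow_comp gmul ginv p.1 p.2],
    continuous (fun p : gpd_space * gpd_space => gmul p.1 p.2)};
  ginv_continuous : continuous ginv
}.

Arguments gmul {t} : rename.
Arguments ginv {t} : rename.

Section Groupoid.
Variable G : topGroupoid.

Definition src : G -> G := arrow_src gmul ginv.
Definition rng : G -> G := arrow_rng gmul ginv.
Definition composable (a b : G) : Prop := src a = rng b.

Definition unit_space : set G := range src.
Definition isotropy : set G := [set a | rng a = src a].

Definition principal : Prop := isotropy = unit_space.
Definition effective : Prop := isotropy° = unit_space.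

Definition open_bisection (B : set G) : Prop :=
  [/\ open B, open (rng @` B), open (src @` B),
      homeo_onto B (rng @` B) rng & homeo_onto B (src @` B) src].

Definition ample : Prop := basis [set B | compact B /\ open_bisection B].

End Groupoid.
Arguments src {G} a.
Arguments rng {G} a.
Arguments unit_space : clear implicits.
Arguments isotropy : clear implicits.
Arguments principal : clear implicits.
Arguments effective : clear implicits.
Arguments ample : clear implicits.

Definition groupoid_hom (G H : topGroupoid) (f : G -> H) : Prop :=
  forall a b : G, composable a b ->
    composable (f a) (f b) /\ f (gmul a b) = gmul (f a) (f b).

Lemma pair_continuous (X Y Z : topologicalType) (f : X -> Y) (g : X -> Z) :
  continuous f -> continuous g -> continuous (fun x => (f x, g x)).
Proof. by move=> cf cg x; apply: cvg_pair; [exact: cf|exact: cg]. Qed.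

Lemma fst_continuous (X Y : topologicalType) : continuous (@fst X Y).
Proof. by move=> [x y]; exact: cvg_fst. Qed.

Lemma snd_continuous (X Y : topologicalType) : continuous (@snd X Y).
Proof. by move=> [x y]; exact: cvg_snd. Qed.

Lemma comp_continuous (X Y Z : topologicalType) (f : X -> Y) (g : Y -> Z) :
  continuous f -> continuous g -> continuous (fun x => g (f x)).
Proof. by move=> cf cg x; apply: continuous_comp; [exact: cf|exact: cg]. Qed.

Definition initial_map (X' X : topologicalType) (phi : X' -> X) : Prop :=
  forall U', open U' <-> exists2 U, open U & phi @^-1` U = U'.

Lemma initial_map_open (X' X : topologicalType) (phi : X' -> X) U :
  initial_map phi -> open U -> open (phi @^-1` U).
Proof. by move=> iphi oU; apply/iphi; exists U. Qed.

Lemma initial_map_val (X : topologicalType) (A : set X) :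
  initial_map (fun x : set_type A => val x).
Proof. by move=> U'. Qed.

Lemma initial_map_prod (X' X Z : topologicalType) (phi : X' -> X) :
  initial_map phi ->
  initial_map (fun p : X' * Z => (phi p.1, p.2)).
Proof.
move=> iphi U'; split; last first.
  move=> [U oU <-]; move: U oU; apply/continuousP.
  apply: pair_continuous; last exact: snd_continuous.
  apply: comp_continuous; first exact: fst_continuous.
  by apply/continuousP => W oW; exact: initial_map_open.
move=> oU'.
exists (\bigcup_(V in [set V : set (X * Z) | open V /\
    (fun p : X' * Z => (phi p.1, p.2)) @^-1` V `<=` U']) V).
  by apply: bigcup_open => V [].
apply/seteqP; split=> [p [V [_ sV] Vp]|[x z] U'xz]; first exact: sV.
move: (oU'); rewrite openE => /(_ _ U'xz) [[P Q]] /= [nP nQ] PQ.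
move: nP nQ; rewrite !nbhsE => -[P' [oP' P'x P'P]] [Q' [oQ' Q'z Q'Q]].
have [P0 oP0 P0E] := (iphi P').1 oP'.
exists (P0 `*` Q'); last by split=> //=; rewrite -P0E in P'x.
split.
  have -> : P0 `*` Q' = (@fst X Z) @^-1` P0 `&` (@snd X Z) @^-1` Q' by [].
  apply: openI; move: oP0 oQ' => o1 o2.
    by apply: open_comp => // p _; exact: fst_continuous.
  by apply: open_comp => // p _; exact: snd_continuous.
move=> [a b] /= [P0a Q'b]; apply: PQ; split=> /=; last exact: Q'Q.
by apply: P'P; rewrite -P0E.
Qed.

Lemma within_continuousP (X Y : topologicalType) (A : set X) (f : X -> Y) :
  {within A, continuous f} <->
  forall W, open W -> exists2 V, open V & V `&` A = f @^-1` W `&` A.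
Proof.
split.
  by move=> /continuousP cf W /cf /open_subspaceP.
move=> H; apply/continuousP => W /H [V oV VE].
by apply/open_subspaceP; exists V.
Qed.

Section Pullback.
Variables (X Y X' Y' : topologicalType) (phi : X' -> X) (psi : Y' -> Y).
Variables (f : X -> Y) (f' : X' -> Y') (A : set X) (A' : set X').
Hypotheses (cphi : continuous phi) (ipsi : initial_map psi).
Hypothesis ff' : forall x, A' x -> psi (f' x) = f (phi x).

Lemma within_continuous_pull : (forall x, A' x -> A (phi x)) ->
  {within A, continuous f} -> {within A', continuous f'}.
Proof.
move=> AA' /within_continuousP cf; apply/within_continuousP.
move=> _ /ipsi[W oW <-]; have [V oV VE] := cf _ oW.
exists (phi @^-1` V); first by move: V oV {VE}; apply/continuousP.
apply/seteqP; split=> x [h A'x]; split=> //=.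
  rewrite ff' //; have : (V `&` A) (phi x) by split=> //; exact: AA'.
  by rewrite VE => -[].
have : (f @^-1` W `&` A) (phi x) by split=> /=; [rewrite -ff'|exact: AA'].
by rewrite -VE => -[].
Qed.

Lemma homeo_onto_pull (B : set Y) (B' : set Y') :
  initial_map phi -> injective phi -> injective psi ->
  (forall x, A' x <-> A (phi x)) -> (forall y, B' y <-> B (psi y)) ->
  (forall x y', A x -> f x = psi y' -> exists x', phi x' = x) ->
  homeo_onto A B f -> homeo_onto A' B' f'.
Proof.
move=> iphi phiI psiI AA' BB' lft [[fAB finj fsurj] cf fop].
split.
- split.
  + by move=> x A'x; apply/BB'; rewrite ff' //; apply/fAB/AA'.
  + move=> x y; rewrite !inE => A'x A'y exy; apply/phiI/finj.
    * by rewrite inE; apply/AA'.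
    * by rewrite inE; apply/AA'.
    * by rewrite -!ff' // exy.
  + move=> y' /BB' /fsurj[x Ax fx].
    have [x' xE] := lft _ _ Ax fx; exists x'; first by apply/AA'; rewrite xE.
    by apply: psiI; rewrite ff' ?xE //; apply/AA'; rewrite xE.
- by apply: within_continuous_pull cf => x /AA'.
- move=> _ /iphi[U oU <-]; have [V oV VE] := fop _ oU.
  exists (psi @^-1` V); first exact: initial_map_open.
  apply/seteqP; split=> [_ [x [A'x Ux] <-]|y [/BB' By Vy]].
    have : (B `&` V) (f (phi x)).
      by rewrite -VE; exists (phi x) => //; split => //; apply/AA'.
    by rewrite -ff' // => -[Bx Vx]; split => //; apply/BB'.
  have : (B `&` V) (psi y) by [].
  rewrite -VE => -[x [Ax Ux] fx]; have [x' xE] := lft _ _ Ax fx.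
  have A'x : A' x' by apply/AA'; rewrite xE.
  exists x'; first by split => //=; rewrite xE.
  by apply: psiI; rewrite ff' // xE.
Qed.

End Pullback.

Lemma homeo_onto_sub (X Y : topologicalType) (A A0 : set X) (B : set Y)
    (f : X -> Y) :
  A0 `<=` A -> homeo_onto A B f -> homeo_onto A0 (f @` A0) f.
Proof.
move=> A0A [[fAB finj fsurj] cf fop]; split.
- apply: inj_bij => x y; rewrite !inE => /A0A Ax /A0A Ay.
  by apply: finj; rewrite inE.
- exact: continuous_subspaceW cf.
- move=> U /fop[V oV VE]; exists V => //.
  apply/seteqP; split=> [_ [x [A0x Ux] <-]|_ [[x A0x <-] Vx]].
    split; first by exists x.
    suff : (B `&` V) (f x) by case.
    by rewrite -VE; exists x => //; split => //; exact: A0A.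
  have : (B `&` V) (f x) by split => //; apply/fAB/A0A.
  rewrite -VE => -[x' [Ax' Ux'] /finj xx']; exists x => //; split => //.
  by rewrite -xx' ?inE //; exact: A0A.
Qed.

Lemma open_bisection_sub (G : topGroupoid) (B B0 : set G) :
  B0 `<=` B -> open B0 -> open_bisection B -> open_bisection B0.
Proof.
move=> sB oB0 [oB orB osB hr hs]; split=> //.
- have [_ _ /(_ _ oB0)[V oV]] := hr; rewrite setIidr // => ->; exact: openI.
- have [_ _ /(_ _ oB0)[V oV]] := hs; rewrite setIidr // => ->; exact: openI.
- exact: homeo_onto_sub hr.
- exact: homeo_onto_sub hs.
Qed.

Record grading (Gamma : groupType) (G : topGroupoid) := Grading {
  grading_fun :> G -> Gamma;
  grading_continuous : continuous (grading_fun : G -> discrete_topology Gamma);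
  gradingM : forall a b : G, composable a b ->
    grading_fun (gmul a b) = (grading_fun a * grading_fun b)%g
}.

Section GroupoidTheory.
Variable G : topGroupoid.
Implicit Types a b : G.

Lemma ginvK : involutive (@ginv G). Proof. exact: gpd_invK (gpdP G). Qed.

Lemma src_inv a : src (ginv a) = rng a.
Proof. by rewrite /src /rng /arrow_src /arrow_rng ginvK. Qed.

Lemma rng_inv a : rng (ginv a) = src a.
Proof. by rewrite /src /rng /arrow_src /arrow_rng ginvK. Qed.

Lemma composableV a : composable a (ginv a).
Proof. by rewrite /composable rng_inv. Qed.

Lemma composableVl a : composable (ginv a) a.
Proof. by rewrite /composable src_inv. Qed.

Lemma rng_rng a : rng (rng a) = rng a.
Proof. exact: gpd_mul_rng (gpdP G) _ _ (composableV a). Qed.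

Lemma src_rng a : src (rng a) = rng a.
Proof.
by rewrite -[RHS]src_inv; exact: gpd_mul_src (gpdP G) _ _ (composableV a).
Qed.

Lemma src_src a : src (src a) = src a.
Proof. exact: gpd_mul_src (gpdP G) _ _ (composableVl a). Qed.

Lemma rng_src a : rng (src a) = src a.
Proof.
by rewrite -[RHS]rng_inv; exact: gpd_mul_rng (gpdP G) _ _ (composableVl a).
Qed.

Lemma unit_rng a : unit_space G (rng a).
Proof. by exists (rng a) => //; rewrite src_rng. Qed.

Lemma unit_spaceE a : unit_space G a <-> rng a = a.
Proof. by split=> [[b _ <-]|<-]; [rewrite rng_src|exact: unit_rng]. Qed.

End GroupoidTheory.

Section Kernel.
Variables (Gamma : groupType) (G : topGroupoid) (c : grading Gamma G).

Lemma grading_rng a : c (rng a) = 1%g.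
Proof.
have h : composable (rng a) (rng a) by rewrite /composable src_rng rng_rng.
have := gradingM c h; rewrite -[X in gmul X _]rng_rng (gpd_rng_mul (gpdP G)).
by move=> e; apply: (mulgI (c (rng a))); rewrite mulg1 -e.
Qed.

Lemma gradingV a : c (ginv a) = (c a)^-1%g.
Proof.
apply: (mulgI (c a)); rewrite mulgV -(gradingM c (composableV a)).
exact: grading_rng.
Qed.

Definition ker : set G := c @^-1` [set 1%g].

Definition ker_mul (a b : ker) : ker := insubd a (gmul (val a) (val b)).
Definition ker_inv (a : ker) : ker := insubd a (ginv (val a)).

Lemma kerP (a : ker) : c (val a) = 1%g.
Proof. exact: set_mem (valP a). Qed.

Lemma val_ker_inv a : val (ker_inv a) = ginv (val a).
Proof. by rewrite insubdK // inE /ker /= gradingV kerP invg1. Qed.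

Lemma val_ker_mul a b :
  composable (val a) (val b) -> val (ker_mul a b) = gmul (val a) (val b).
Proof. by move=> ab; rewrite insubdK // inE /ker /= gradingM // !kerP mulg1. Qed.

Lemma val_ker_src a : val (arrow_src ker_mul ker_inv a) = src (val a).
Proof.
by rewrite /arrow_src val_ker_mul val_ker_inv //; exact: composableVl.
Qed.

Lemma val_ker_rng a : val (arrow_rng ker_mul ker_inv a) = rng (val a).
Proof. by rewrite /arrow_rng val_ker_mul val_ker_inv //; exact: composableV. Qed.

Lemma ker_compE a b :
  arrow_comp ker_mul ker_inv a b <-> composable (val a) (val b).
Proof.
rewrite /composable -val_ker_src -val_ker_rng.
by split=> [e|e]; [congr (val _)|exact: val_inj].
Qed.

Lemma ker_groupoid : is_groupoid ker_mul ker_inv.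
Proof.
have G0 := gpdP G; split.
- by move=> a; apply: val_inj; rewrite !val_ker_inv ginvK.
- move=> a b /ker_compE ab; apply: val_inj; rewrite !val_ker_src val_ker_mul //.
  exact: gpd_mul_src.
- move=> a b /ker_compE ab; apply: val_inj; rewrite !val_ker_rng val_ker_mul //.
  exact: gpd_mul_rng.
- move=> a b d /ker_compE ab /ker_compE bd; apply: val_inj.
  have ab_d : composable (gmul (val a) (val b)) (val d).
    by rewrite /composable -bd; exact: gpd_mul_src.
  have a_bd : composable (val a) (gmul (val b) (val d)).
    by rewrite /composable ab; apply/esym; exact: gpd_mul_rng.
  by rewrite !val_ker_mul // ?val_ker_mul //; exact: (gpd_mulA G0 ab bd).
- move=> a; apply: val_inj; rewrite val_ker_mul val_ker_rng.
    exact: gpd_rng_mul.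
  by rewrite /composable src_rng.
- move=> a; apply: val_inj; rewrite val_ker_mul val_ker_src.
    exact: gpd_mul_srcr.
  by rewrite /composable rng_src.
Qed.

Lemma ker_mul_continuous :
  {within [set p | arrow_comp ker_mul ker_inv p.1 p.2],
    continuous (fun p : ker * ker => ker_mul p.1 p.2)}.
Proof.
apply: (within_continuous_pull
  (phi := fun p : ker * ker => (val p.1, val p.2))
  (psi := fun a : ker => val a)
  (f := fun p : G * G => gmul p.1 p.2)
  (A := [set p : G * G | composable p.1 p.2])).
- apply: pair_continuous; apply: comp_continuous.
  + exact: fst_continuous.
  + exact: initial_continuous.
  + exact: snd_continuous.
  + exact: initial_continuous.
- exact: initial_map_val.
- by move=> [a b] /= /ker_compE; exact: val_ker_mul.
- by move=> [a b] /= /ker_compE.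
- exact: gmul_continuous.
Qed.

Lemma ker_inv_continuous : continuous ker_inv.
Proof.
apply/continuous_subspace_setT.
apply: (within_continuous_pull (phi := fun a : ker => val a)
  (psi := fun a : ker => val a) (f := ginv) (A := setT)).
- exact: initial_continuous.
- exact: initial_map_val.
- by move=> a _; exact: val_ker_inv.
- by [].
- by apply: continuous_subspaceT; exact: ginv_continuous.
Qed.

Definition eps_groupoid : topGroupoid :=
  TopGroupoid ker_groupoid ker_mul_continuous ker_inv_continuous.

End Kernel.

(* tw_i x t is i(x, t); only its values at units x of G matter.  The unit
   spaces of Sigma and G are identified through tw_q. *)
Record twist (R : comUnitRingType) (G Sigma : topGroupoid) := Twist {
  tw_i : G -> units R -> Sigma;
  tw_q : Sigma -> G;
  tw_i_continuous : {within unit_space G `*` setT,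
    continuous (fun p : G * discrete_topology (units R) => tw_i p.1 p.2)};
  tw_i_hom : forall x s t, unit_space G x ->
    composable (tw_i x s) (tw_i x t) /\
    tw_i x (s * t)%g = gmul (tw_i x s) (tw_i x t);
  tw_q_continuous : continuous tw_q;
  tw_q_hom : groupoid_hom tw_q;
  tw_unit_space : unit_space Sigma = [set tw_i x 1%g | x in unit_space G];
  tw_i_units :
    homeo_onto (unit_space G) (unit_space Sigma) (fun x => tw_i x 1%g);
  tw_q_units : homeo_onto (unit_space Sigma) (unit_space G) tw_q;
  tw_fibre : forall x, unit_space G x -> range (tw_i x) = tw_q @^-1` [set x];
  tw_i_inj : forall x y s t, unit_space G x -> unit_space G y ->
    tw_i x s = tw_i y t -> x = y /\ s = t;
  tw_q_surj : range tw_q = setT;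
  tw_local : forall a : G, exists (B : set G) (P : G -> Sigma),
    [/\ open_bisection B /\ B a,
        {within B, continuous P},
        forall b, B b -> tw_q (P b) = b &
        homeo_onto (B `*` setT) (tw_q @^-1` B)
          (fun p : G * discrete_topology (units R) =>
             gmul (tw_i (rng p.1) p.2) (P p.1))];
  tw_central : forall sigma t,
    gmul (tw_i (tw_q (rng sigma)) t) sigma =
    gmul sigma (tw_i (tw_q (src sigma)) t)
}.

Record gradedTwist (R : comUnitRingType) (Gamma : groupType)
    (G Sigma : topGroupoid) := GradedTwist {
  gt_twist :> twist R G Sigma;
  gt_G : grading Gamma G;
  gt_Sigma : grading Gamma Sigma;
  gt_compat : forall sigma, gt_Sigma sigma = gt_G (tw_q gt_twist sigma)
}.

Section EpsTwist.
Variables (R : comUnitRingType) (Gamma : groupType) (G Sigma : topGroupoid).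
Variable T : gradedTwist R Gamma G Sigma.

Local Notation Ge := (eps_groupoid (gt_G T)).
Local Notation Se := (eps_groupoid (gt_Sigma T)).
Local Notation i := (tw_i T).
Local Notation q := (tw_q T).
Local Notation UR := (discrete_topology (units R)).

Lemma val_eps_rng (H : topGroupoid) (c : grading Gamma H)
  (x : eps_groupoid c) : val (rng x) = rng (val x).
Proof. exact: val_ker_rng. Qed.

Lemma val_eps_src (H : topGroupoid) (c : grading Gamma H)
  (x : eps_groupoid c) : val (src x) = src (val x).
Proof. exact: val_ker_src. Qed.

Lemma eps_composable (H : topGroupoid) (c : grading Gamma H)
  (x y : eps_groupoid c) : composable x y <-> composable (val x) (val y).
Proof. exact: ker_compE. Qed.

Lemma val_eps_mul (H : topGroupoid) (c : grading Gamma H)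
  (x y : eps_groupoid c) : composable (val x) (val y) ->
  val (gmul x y) = gmul (val x) (val y).
Proof. exact: val_ker_mul. Qed.

Lemma eps_unit (H : topGroupoid) (c : grading Gamma H) (x : eps_groupoid c) :
  unit_space _ x <-> unit_space _ (val x).
Proof.
rewrite !unit_spaceE -val_eps_rng.
by split=> [->//|]; exact: val_inj.
Qed.

Lemma val_eps_continuous (H : topGroupoid) (c : grading Gamma H) :
  continuous (fun x : eps_groupoid c => val x : H).
Proof. exact: initial_continuous. Qed.

Lemma eps_initial (H : topGroupoid) (c : grading Gamma H) :
  initial_map (fun x : eps_groupoid c => val x : H).
Proof. exact: initial_map_val. Qed.

Definition ker_elt (H : topGroupoid) (c : grading Gamma H) (x : H)
  (xc : x \in ker c) : eps_groupoid c := exist (fun y => y \in ker c) x xc.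

Lemma tw_qi x t : q (i (rng x) t) = rng x.
Proof.
have : range (i (rng x)) (i (rng x) t) by exists t.
by rewrite (tw_fibre T (unit_rng x)).
Qed.

Lemma tw_q_unit s : unit_space Sigma s -> unit_space G (q s).
Proof. by have [[h _ _] _ _] := tw_q_units T; exact: h. Qed.

Lemma tw_q_rng s : q (rng s) = rng (q s).
Proof.
have rs_s : composable (rng s) s by rewrite /composable src_rng.
have [<- _] := tw_q_hom T rs_s.
have /unit_spaceE <- := tw_q_unit (unit_rng s).
by rewrite src_rng.
Qed.

Lemma tw_q_src s : q (src s) = src (q s).
Proof.
have s_ss : composable s (src s) by rewrite /composable rng_src.
have [-> _] := tw_q_hom T s_ss; apply/esym/unit_spaceE/tw_q_unit.
by exists s.
Qed.

Lemma tw_i1 x : unit_space G x -> unit_space Sigma (i x 1%g).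
Proof. by move=> ux; rewrite (tw_unit_space T); exists x. Qed.

Lemma tw_i1q s : unit_space Sigma s -> i (q s) 1%g = s.
Proof.
rewrite (tw_unit_space T) => -[x /unit_spaceE ux <-].
by rewrite -[in q _]ux tw_qi ux.
Qed.

Lemma src_tw_i x t : unit_space G x -> src (i x t) = i x 1%g.
Proof.
move=> ux; have [-> _] := tw_i_hom T t 1%g ux.
by apply/unit_spaceE/tw_i1.
Qed.

Lemma rng_tw_i x t : unit_space G x -> rng (i x t) = i x 1%g.
Proof. by move=> ux; have [<- _] := tw_i_hom T 1%g t ux; rewrite src_tw_i. Qed.

Lemma composable_il s t : composable (i (q (rng s)) t) s.
Proof.
rewrite /composable src_tw_i; first exact/tw_i1q/unit_rng.
exact/tw_q_unit/unit_rng.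
Qed.

Lemma composable_ir s t : composable s (i (q (src s)) t).
Proof.
rewrite /composable rng_tw_i; first by rewrite tw_i1q //; exists s.
by apply/tw_q_unit; exists s.
Qed.

Lemma eps_iP (x : Ge) t : i (rng (val x)) t \in ker (gt_Sigma T).
Proof. by rewrite inE /ker /= gt_compat tw_qi grading_rng. Qed.

Lemma eps_qP (sigma : Se) : q (val sigma) \in ker (gt_G T).
Proof. by rewrite inE /ker /= -gt_compat kerP. Qed.

(* Precomposing with rng, the identity on units, makes eps_i total. *)
Definition eps_i (x : Ge) (t : units R) : Se := ker_elt (eps_iP x t).
Definition eps_q (sigma : Se) : Ge := ker_elt (eps_qP sigma).

Lemma val_eps_i x t : unit_space Ge x -> val (eps_i x t) = i (val x) t.
Proof. by move=> /eps_unit/unit_spaceE xE /=; rewrite xE. Qed.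

Lemma eps_i_continuous : {within unit_space Ge `*` setT,
  continuous (fun p : Ge * UR => eps_i p.1 p.2)}.
Proof.
apply: (within_continuous_pull
  (phi := fun p : Ge * UR => (val p.1, p.2) : G * UR)
  (psi := fun s : Se => val s) (f := fun p : G * UR => i p.1 p.2)
  (A := unit_space G `*` setT)).
- apply: pair_continuous; last exact: snd_continuous.
  by apply: comp_continuous; [exact: fst_continuous|exact: val_eps_continuous].
- exact: eps_initial.
- by move=> [x t] /= [ux _]; rewrite -val_eps_i.
- by move=> [x t] /= [/eps_unit ux _].
- exact: tw_i_continuous.
Qed.

Lemma eps_i_hom x s t : unit_space Ge x ->
  composable (eps_i x s) (eps_i x t) /\
  eps_i x (s * t)%g = gmul (eps_i x s) (eps_i x t).
Proof.
move=> ux; have [cst mst] := tw_i_hom T s t ((eps_unit x).1 ux).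
have cst' : composable (val (eps_i x s)) (val (eps_i x t)).
  by rewrite !val_eps_i.
split; first exact/eps_composable.
by apply: val_inj; rewrite val_eps_mul // !val_eps_i.
Qed.

Lemma eps_q_continuous : continuous eps_q.
Proof.
apply/continuousP => _ /eps_initial[V oV <-].
have : open ((fun s : Se => q (val s)) @^-1` V); last by [].
move: V oV; apply/continuousP; apply: comp_continuous.
  exact: val_eps_continuous.
exact: tw_q_continuous.
Qed.

Lemma eps_q_hom : groupoid_hom eps_q.
Proof.
move=> a b /eps_composable ab; have [cab mab] := tw_q_hom T ab.
split; first exact/eps_composable.
by apply: val_inj; rewrite val_eps_mul //= val_ker_mul.
Qed.

Lemma eps_unit_space :
  unit_space Se = [set eps_i x 1%g | x in unit_space Ge].
Proof.
apply/seteqP; split=> [s /eps_unit|_ [x ux <-]].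
  rewrite (tw_unit_space T) => -[x ux xs].
  have xG : x \in ker (gt_G T).
    by move/unit_spaceE: ux => <-; rewrite inE /ker /= grading_rng.
  exists (ker_elt xG); first exact/eps_unit.
  by apply: val_inj; rewrite val_eps_i //; exact/eps_unit.
apply/eps_unit; rewrite val_eps_i // (tw_unit_space T).
by exists (val x) => //; exact/eps_unit.
Qed.

Lemma unit_lift (H : topGroupoid) (c : grading Gamma H) (x : H) :
  unit_space H x -> exists x' : eps_groupoid c, val x' = x.
Proof.
move=> /unit_spaceE ux; have xG : x \in ker c.
  by rewrite -ux inE /ker /= grading_rng.
by exists (ker_elt xG).
Qed.

Lemma eps_i_units :
  homeo_onto (unit_space Ge) (unit_space Se) (fun x => eps_i x 1%g).
Proof.
apply: (homeo_onto_pull (phi := fun x : Ge => val x)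
  (psi := fun s : Se => val s) _ _ _ _ _ _ _ _ _ (tw_i_units T)).
- exact: val_eps_continuous.
- exact: eps_initial.
- by move=> x ux; rewrite -val_eps_i.
- exact: eps_initial.
- exact: val_inj.
- exact: val_inj.
- exact: eps_unit.
- exact: eps_unit.
- by move=> x y' ux _; exact: unit_lift.
Qed.

Lemma eps_q_units : homeo_onto (unit_space Se) (unit_space Ge) eps_q.
Proof.
apply: (homeo_onto_pull (phi := fun x : Se => val x)
  (psi := fun s : Ge => val s) _ _ _ _ _ _ _ _ _ (tw_q_units T)).
- exact: val_eps_continuous.
- exact: eps_initial.
- by [].
- exact: eps_initial.
- exact: val_inj.
- exact: val_inj.
- exact: eps_unit.
- exact: eps_unit.
- by move=> x y' ux _; exact: unit_lift.
Qed.

Lemma eps_tw_fibre x :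
  unit_space Ge x -> range (eps_i x) = eps_q @^-1` [set x].
Proof.
move=> ux; have ux' := (eps_unit x).1 ux; have fx := tw_fibre T ux'.
apply/seteqP; split=> [_ [t _ <-]|s /= sx].
  apply: val_inj; rewrite [LHS]/= (_ : rng (val x) = val x).
    have : range (i (val x)) (i (val x) t) by exists t.
    by rewrite fx.
  exact/unit_spaceE.
have : (q @^-1` [set val x]) (val s) by rewrite -sx.
rewrite -fx => -[t _ ts]; exists t => //.
by apply: val_inj; rewrite val_eps_i.
Qed.

Lemma eps_i_inj x y s t : unit_space Ge x -> unit_space Ge y ->
  eps_i x s = eps_i y t -> x = y /\ s = t.
Proof.
move=> ux uy /(congr1 val); rewrite !val_eps_i //.
by move=> /tw_i_inj[||/val_inj -> ->//]; exact/eps_unit.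
Qed.

Lemma eps_q_surj : range eps_q = setT.
Proof.
apply/seteqP; split=> // x _.
have : range q (val x) by rewrite (tw_q_surj T).
move=> [s _ sx]; have sG : s \in ker (gt_Sigma T).
  by rewrite inE /ker /= gt_compat sx kerP.
by exists (ker_elt sG) => //; apply: val_inj.
Qed.

Lemma open_ker (H : topGroupoid) (c : grading Gamma H) : open (ker c).
Proof.
have := continuousP (c : H -> discrete_topology Gamma).
by move=> [/(_ (@grading_continuous _ _ c)) h _]; apply/h/discrete_open.
Qed.

Lemma eps_open_bisection (B : set G) : B `<=` ker (gt_G T) ->
  open_bisection B -> open_bisection ((fun x : Ge => val x) @^-1` B).
Proof.
move=> BG [oB orB osB hr hs].
have rE : rng @` ((fun x : Ge => val x) @^-1` B) =
    (fun x : Ge => val x) @^-1` (rng @` B).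
  apply/seteqP; split=> [_ [x Bx <-]|y [x Bx xy]].
    by exists (val x) => //; rewrite val_eps_rng.
  have xG : x \in ker (gt_G T) by rewrite inE; exact: BG.
  by exists (ker_elt xG) => //; apply: val_inj; rewrite val_eps_rng.
have sE : src @` ((fun x : Ge => val x) @^-1` B) =
    (fun x : Ge => val x) @^-1` (src @` B).
  apply/seteqP; split=> [_ [x Bx <-]|y [x Bx xy]].
    by exists (val x) => //; rewrite val_eps_src.
  have xG : x \in ker (gt_G T) by rewrite inE; exact: BG.
  by exists (ker_elt xG) => //; apply: val_inj; rewrite val_eps_src.
have lft x : B x -> exists x' : Ge, val x' = x.
  move=> Bx; have xG : x \in ker (gt_G T) by rewrite inE; exact: BG.
  by exists (ker_elt xG).
split; rewrite ?rE ?sE; try by apply: initial_map_open => //; exact: eps_initial.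
- apply: (homeo_onto_pull (phi := fun x : Ge => val x)
    (psi := fun s : Ge => val s) _ _ _ _ _ _ _ _ _ hr).
  + exact: val_eps_continuous.
  + exact: eps_initial.
  + by move=> x _; exact: val_eps_rng.
  + exact: eps_initial.
  + exact: val_inj.
  + exact: val_inj.
  + by [].
  + by [].
  + by move=> x y' /lft.
- apply: (homeo_onto_pull (phi := fun x : Ge => val x)
    (psi := fun s : Ge => val s) _ _ _ _ _ _ _ _ _ hs).
  + exact: val_eps_continuous.
  + exact: eps_initial.
  + by move=> x _; exact: val_eps_src.
  + exact: eps_initial.
  + exact: val_inj.
  + exact: val_inj.
  + by [].
  + by [].
  + by move=> x y' /lft.
Qed.

Lemma eps_local (a : Ge) : exists (B : set Ge) (P : Ge -> Se),
  [/\ open_bisection B /\ B a,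
      {within B, continuous P},
      forall b, B b -> eps_q (P b) = b &
      homeo_onto (B `*` setT) (eps_q @^-1` B)
        (fun p : Ge * UR => gmul (eps_i (rng p.1) p.2) (P p.1))].
Proof.
have [B [P [[bB Ba] cP qP hP]]] := tw_local T (val a).
pose B0 := B `&` ker (gt_G T).
have B0B : B0 `<=` B by move=> x [].
have oB0 : open B0 by case: bB => oB *; apply: openI => //; exact: open_ker.
have bB0 : open_bisection B0 := open_bisection_sub B0B oB0 bB.
pose P' (x : Ge) : Se := insubd (eps_i (rng x) 1%g) (P (val x)).
have vP' x : B (val x) -> val (P' x) = P (val x).
  move=> Bx; rewrite insubdK // inE /ker /= gt_compat qP //; exact: kerP.
exists ((fun x : Ge => val x) @^-1` B0), P'; split.
- split; last by split => //; exact: kerP.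
  by apply: eps_open_bisection => // x [].
- apply: (within_continuous_pull (phi := fun x : Ge => val x)
    (psi := fun s : Se => val s) _ _ _ _ cP).
  + exact: val_eps_continuous.
  + exact: eps_initial.
  + by move=> x [Bx _]; exact: vP'.
  + by move=> x [].
- by move=> b [Bb _]; apply: val_inj; rewrite /= vP' // qP.
have imE : (fun p : G * UR => gmul (i (rng p.1) p.2) (P p.1)) @`
    (B0 `*` setT) = q @^-1` B0.
  have [[hf hi hs] _ _] := hP.
  have qf x t : B x -> q (gmul (i (rng x) t) (P x)) = x.
    move=> Bx; have : composable (i (rng x) t) (P x).
      by rewrite -{1}(qP _ Bx) -tw_q_rng; exact: composable_il.
    move=> /(tw_q_hom T)[_ ->]; rewrite tw_qi qP //.
    exact: gpd_rng_mul (gpdP G) _.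
  apply/seteqP; split=> [_ [[x t] [[Bx Gx] _] <-]|s [Bs Gs]] /=.
    by rewrite /preimage /= qf.
  have [[x t] [Bx _] xs] := hs s Bs; exists (x, t) => //; split=> //.
  by split => //=; move: Gs; rewrite -xs /= qf.
have hP0 : homeo_onto (B0 `*` setT) (q @^-1` B0)
    (fun p : G * UR => gmul (i (rng p.1) p.2) (P p.1)).
  by rewrite -imE; apply: homeo_onto_sub hP => -[x t] [[]].
apply: (homeo_onto_pull (phi := fun p : Ge * UR => (val p.1, p.2) : G * UR)
  (psi := fun s : Se => val s) _ _ _ _ _ _ _ _ _ hP0).
- apply: pair_continuous; last exact: snd_continuous.
  by apply: comp_continuous; [exact: fst_continuous|exact: val_eps_continuous].
- exact: eps_initial.
- move=> [x t] /= [[Bx _] _].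
  have e : val (eps_i (rng x) t) = i (rng (val x)) t.
    by rewrite val_eps_i ?val_eps_rng //; exact: unit_rng.
  have cx : composable (i (rng (val x)) t) (P (val x)).
    by have := composable_il (P (val x)) t; rewrite tw_q_rng qP.
  by rewrite val_eps_mul e vP'.
- by apply: initial_map_prod; exact: eps_initial.
- by move=> [x t] [y u] /= [/val_inj -> ->].
- exact: val_inj.
- by [].
- by [].
- move=> [x t] y' /= [[Bx Gx] _] _.
  have xG : x \in ker (gt_G T) by rewrite inE.
  by exists (ker_elt xG, t).
Qed.

Lemma eps_central (sigma : Se) (t : units R) :
  gmul (eps_i (eps_q (rng sigma)) t) sigma =
  gmul sigma (eps_i (eps_q (src sigma)) t).
Proof.
have er : val (eps_i (eps_q (rng sigma)) t) = i (q (rng (val sigma))) t.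
  rewrite val_eps_i /= ?val_ker_rng //; apply/eps_unit => /=.
  by rewrite val_ker_rng; exact/tw_q_unit/unit_rng.
have es : val (eps_i (eps_q (src sigma)) t) = i (q (src (val sigma))) t.
  rewrite val_eps_i /= ?val_ker_src //; apply/eps_unit => /=.
  by rewrite val_ker_src; apply/tw_q_unit; exists (val sigma).
apply: val_inj; rewrite !val_eps_mul ?er ?es.
- exact: tw_central.
- exact: composable_ir.
- exact: composable_il.
Qed.

Definition eps_twist : twist R Ge Se :=
  Twist eps_i_continuous eps_i_hom eps_q_continuous eps_q_hom eps_unit_space
    eps_i_units eps_q_units eps_tw_fibre eps_i_inj eps_q_surj eps_local
    eps_central.

End EpsTwist.

Section Steinberg.
Variables (R : comUnitRingType) (G Sigma : topGroupoid) (T : twist R G Sigma).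

Definition tw_act (t : units R) (sigma : Sigma) : Sigma :=
  gmul (tw_i T (tw_q T (rng sigma)) t) sigma.

Definition supp (f : Sigma -> R^o) : set Sigma := [set sigma | f sigma != 0].
Definition suppG (f : Sigma -> R^o) : set G := tw_q T @` supp f.

Definition steinberg : set (Sigma -> R^o) :=
  [set f | [/\ locally_constant f,
     forall (t : units R) sigma, f (tw_act t sigma) = (val t)^-1 * f sigma &
     compact (suppG f)]].

(* The summation set is finite when f is in the algebra; the sum does not
   depend on the section S of tw_q over suppG f. *)
Definition conv_section (S : G -> Sigma) (f g : Sigma -> R^o) : Sigma -> R^o :=
  fun sigma =>
    \sum_(a \in [set a | suppG f a /\ rng a = tw_q T (rng sigma)])
      f (S a) * g (gmul (ginv (S a)) sigma).

Definition conv (f g : Sigma -> R^o) : Sigma -> R^o := fun sigma =>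
  conv_section (fun a => xget sigma [set tau | supp f tau /\ tw_q T tau = a])
    f g sigma.

Definition steinberg_diag : set (Sigma -> R^o) :=
  [set f | steinberg f /\ suppG f `<=` unit_space G].

Definition steinberg_comp (Gamma : groupType) (c : G -> Gamma) (gamma : Gamma) :
  set (Sigma -> R^o) :=
  [set f | steinberg f /\ suppG f `<=` c @^-1` [set gamma]].

End Steinberg.

(* A (not necessarily unital) R-algebra is a submodule B of an R-module V, with
   a product that is total on V but subject to the algebra axioms only on B. *)
Section Pairs.
Variables (R : comUnitRingType) (V : lmodType R) (mul : V -> V -> V).
Implicit Types A B C D S : set V.
Local Notation "a ** b" := (mul a b) (at level 40, left associativity).

Definition is_submodule B : Prop :=
  [/\ B 0, forall a b, B a -> B b -> B (a + b) &
      forall (t : R) a, B a -> B (t *: a)].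

Definition is_algebra B : Prop :=
  [/\ is_submodule B,
      forall a b, B a -> B b -> B (a ** b),
      forall a b c, B a -> B b -> B c -> (a ** b) ** c = a ** (b ** c),
      forall (t : R) a b c, B a -> B b -> B c ->
        (t *: a + b) ** c = t *: (a ** c) + b ** c &
      forall (t : R) a b c, B a -> B b -> B c ->
        a ** (t *: b + c) = t *: (a ** b) + a ** c].

Definition commutative_subalgebra B C : Prop :=
  [/\ C `<=` B, is_submodule C,
      forall a b, C a -> C b -> C (a ** b) &
      forall a b, C a -> C b -> a ** b = b ** a].

Definition lin_span S : set V :=
  [set v | exists s : seq (R * V),
     (forall p, p \in s -> S p.2) /\ v = \sum_(p <- s) p.1 *: p.2].

Definition idempotents C : set V := [set e | C e /\ e ** e = e].

Definition normaliser_pair B C (n m : V) : Prop :=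
  [/\ B n /\ B m, m ** n ** m = m, n ** m ** n = n &
      forall c, C c -> C (m ** c ** n) /\ C (n ** c ** m)].

Definition normalisers B C : set V := [set n | exists m, normaliser_pair B C n m].

Definition local_units B C : Prop :=
  forall F : set V, finite_set F -> F `<=` B ->
    exists2 e, idempotents C e & forall a, F a -> e ** a = a /\ a ** e = a.

(* The element m is the inverse of n, unique in the presence of local units. *)
Definition free_normalisers B C : set V :=
  [set n | normalisers B C n /\
     (C n \/ exists2 m, normaliser_pair B C n m & (m ** n) ** (n ** m) = 0)].

Definition without_torsion C : Prop :=
  forall e (t : R), idempotents C e -> e <> 0 -> t *: e = 0 -> t = 0.

Definition conditional_expectation B C (P : V -> V) : Prop :=
  [/\ forall b, B b -> C (P b),
      forall (t : R) a b, B a -> B b -> P (t *: a + b) = t *: P a + P b,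
      forall c, C c -> P c = c &
      forall c b c', C c -> B b -> C c' -> P (c ** b ** c') = c ** P b ** c'].

Definition faithful B C (P : V -> V) : Prop :=
  forall b, B b -> b <> 0 -> exists2 n, normalisers B C n & P (n ** b) <> 0.

Definition implemented_by_idempotents B C (P : V -> V) : Prop :=
  forall n, normalisers B C n ->
    exists2 e, idempotents C e & P n = n ** e /\ n ** e = e ** n.

Definition algebraic_pair B C : Prop :=
  [/\ is_algebra B /\ commutative_subalgebra B C, without_torsion C &
   [/\ local_units B C,
      C = lin_span (idempotents C),
      B = lin_span (normalisers B C) &
      exists2 P, conditional_expectation B C P & faithful B C P]].

Definition maximal_commutative B C : Prop :=
  forall D, commutative_subalgebra B D -> C `<=` D -> D = C.

Definition algebraic_diagonal_pair B C : Prop :=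
  algebraic_pair B C /\ B = lin_span (free_normalisers B C).

Definition algebraic_Cartan_pair B C : Prop :=
  algebraic_pair B C /\ maximal_commutative B C.

Definition algebraic_quasi_Cartan_pair B C : Prop :=
  algebraic_pair B C /\
  exists P, [/\ conditional_expectation B C P, faithful B C P &
                implemented_by_idempotents B C P].

Section Graded.
Variable Gamma : groupType.
Implicit Type Ah : Gamma -> set V.

Definition graded_algebra A Ah : Prop :=
  [/\ is_algebra A /\ forall g, is_submodule (Ah g) /\ Ah g `<=` A,
      A = lin_span (\bigcup_g Ah g),
      forall (s : seq Gamma) (a : Gamma -> V), uniq s ->
        (forall g, Ah g (a g)) -> \sum_(g <- s) a g = 0 ->
        forall g, g \in s -> a g = 0 &
      forall g h a b, Ah g a -> Ah h b -> Ah (g * h)%g (a ** b)].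

Definition homogeneous_normalisers A Ah C : set V :=
  \bigcup_g (normalisers A C `&` Ah g).

Definition graded_pair (pair : set V -> set V -> Prop) A Ah C : Prop :=
  [/\ graded_algebra A Ah, commutative_subalgebra (Ah 1%g) C, pair (Ah 1%g) C &
      A = lin_span (homogeneous_normalisers A Ah C)].

Definition graded_algebraic_diagonal_pair := graded_pair algebraic_diagonal_pair.
Definition graded_algebraic_Cartan_pair := graded_pair algebraic_Cartan_pair.
Definition graded_algebraic_quasi_Cartan_pair :=
  graded_pair algebraic_quasi_Cartan_pair.

End Graded.

End Pairs.

Definition local_bisection_hypothesis (R : comUnitRingType)
    (G Sigma : topGroupoid) (T : twist R G Sigma) : Prop :=
  forall n, normalisers (conv T) (steinberg T) (steinberg_diag T) n ->
    open_bisection (suppG T n).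

(* Main.v *)
Require Import Defs.
From mathcomp Require Import all_boot all_order all_algebra.
From mathcomp Require Import all_classical all_reals topology.

(** The twisted Steinberg algebra is generated, as a module, by very simple
    functions. Around every arrow the twist is trivialised by a continuous
    section [P] over a compact open bisection [U], and in that trivialisation
    one can take the indicator function [chi U P] of [U]. A locally constant
    equivariant function of compact support is a finite sum of multiples of such
    indicators, with [U] inside its support and as small as desired
    ([steinberg_ind]). On the other hand, if one factor of a convolution is
    supported on a bisection, then each value of the product is a single product
    of values ([conv_rng_injective], [conv_src_injective]). These two facts give
    the algebra structure: closure under convolution ([steinberg_conv]) and
    associativity ([convA]) are checked on indicators. They also give the spans
    by normalisers, since a function with unit values supported on a bisection
    is a normaliser, whose inverse is read off by inverting arrows and values
    ([normaliser_unit_bisection]).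

    Everything is done in the subalgebra [steinberg_on Z] of the functions
    supported in an open subgroupoid [Z] that contains all units. For [Z] the
    kernel of the grading this is the homogeneous component of degree the
    identity, and for [Z] the whole groupoid it is the algebra itself. The
    diagonal [C] acts on functions by pointwise multiplication along the source
    or the range, and, the ring being indecomposable, its idempotents take only
    the values 0 and 1 on units. Restriction to the unit space, which is clopen
    as the groupoid is Hausdorff, is a faithful conditional expectation.

    If the kernel is effective, a function that commutes with [C] vanishes on
    arrows with distinct range and source, so the part of its support outside
    the units is an open set of isotropy, which is empty
    ([steinberg_maximal_commutative]). If the kernel is principal, the bisections
    [U] can be taken either inside the units or with disjoint source and range,
    and then the normalisers are free ([steinberg_free_span]).

    For the third part, an expectation implemented by idempotents must kill the
    indicators of bisections that avoid the units, hence it is restriction to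
    the units ([implemented_expectation_unique]). Restriction is implemented by
    idempotents at a normaliser exactly when a unit of its support is the only
    arrow there with that source or that range; since the normalisers are stable
    under multiplication by those of small bisections, which translate any arrow
    to a unit, this says that all their supports are bisections
    ([implemented_bisection_normalisers], [expectation_implemented]). It remains
    to identify the functions supported on the kernel with the algebra of the
    restricted twist ([local_bisection_ker]). *)

Set Implicit Arguments.
Unset Strict Implicit.
Unset Printing Implicit Defensive.

Import GRing.Theory.
Local Open Scope classical_set_scope.
Local Open Scope ring_scope.

(** * Groupoids with total products, and ample Hausdorff topologies *)

Section GroupoidAlgebra.
Variable H : topGroupoid.
Implicit Types a b c u : H.

Lemma rng_mul a b : composable a b -> rng (gmul a b) = rng a.
Proof. exact: gpd_mul_rng (gpdP H) a b. Qed.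

Lemma src_mul a b : composable a b -> src (gmul a b) = src b.
Proof. exact: gpd_mul_src (gpdP H) a b. Qed.

Lemma gmulA a b c : composable a b -> composable b c ->
  gmul (gmul a b) c = gmul a (gmul b c).
Proof. exact: gpd_mulA (gpdP H) a b c. Qed.

Lemma gmul_rng a : gmul (rng a) a = a.
Proof. exact: gpd_rng_mul (gpdP H) a. Qed.

Lemma gmul_src a : gmul a (src a) = a.
Proof. exact: gpd_mul_srcr (gpdP H) a. Qed.

Lemma gmulV a : gmul a (ginv a) = rng a. Proof. by []. Qed.
Lemma gmulVl a : gmul (ginv a) a = src a. Proof. by []. Qed.

Lemma unit_src a : unit_space H (src a). Proof. by exists a. Qed.

Lemma src_unit u : unit_space H u -> src u = u.
Proof. by case=> a _ <-; rewrite src_src. Qed.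

Lemma rng_unit u : unit_space H u -> rng u = u.
Proof. by move/unit_spaceE. Qed.

Lemma gmulKl a b : composable a b -> gmul (ginv a) (gmul a b) = b.
Proof.
move=> ab; rewrite -gmulA //; last exact: composableVl.
by rewrite gmulVl ab gmul_rng.
Qed.

Lemma gmulVKl a b : rng a = rng b -> gmul a (gmul (ginv a) b) = b.
Proof.
move=> ab; rewrite -gmulA //; first by rewrite gmulV ab gmul_rng.
- exact: composableV.
- by rewrite /composable src_inv.
Qed.

Lemma gmulKr a b : composable a b -> gmul (gmul a b) (ginv b) = a.
Proof.
move=> ab; rewrite gmulA //; last exact: composableV.
by rewrite gmulV -ab gmul_src.
Qed.

Lemma gmulVKr a b : src a = src b -> gmul (gmul a (ginv b)) b = a.
Proof.
move=> ab; rewrite gmulA //.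
- by rewrite gmulVl -ab gmul_src.
- by rewrite /composable rng_inv.
- exact: composableVl.
Qed.

Lemma ginv_unit u : unit_space H u -> ginv u = u.
Proof.
move=> uu; rewrite -[LHS]gmul_src src_inv rng_unit //.
by rewrite gmulVl src_unit.
Qed.

Lemma ginvM a b : composable a b -> ginv (gmul a b) = gmul (ginv b) (ginv a).
Proof.
move=> ab.
have ba : composable (ginv b) (ginv a) by rewrite /composable src_inv rng_inv.
have e : gmul (gmul a b) (gmul (ginv b) (ginv a)) = rng a.
  rewrite gmulA //; last by rewrite /composable rng_mul // rng_inv.
  by rewrite gmulVKl ?rng_inv.
rewrite -[RHS](@gmulKl (gmul a b)); first by rewrite e -[in rng a](rng_mul ab)
  -src_inv gmul_src.
by rewrite /composable src_mul // rng_mul // rng_inv.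
Qed.

(** The product of a topological groupoid is continuous only relative to the set
    of composable pairs, so convergence of a product needs composability near
    the limit. *)
Lemma gmul_cvg (X : Type) (F : set_system X) (FF : Filter F) (f g : X -> H)
    a b : composable a b -> f @ F --> a -> g @ F --> b ->
  (\forall x \near F, composable (f x) (g x)) ->
  (fun x => gmul (f x) (g x)) @ F --> gmul a b.
Proof.
move=> ab fa gb cfg.
have /subspace_continuousP/(_ (a, b) ab) h := @gmul_continuous H.
apply: (cvg_trans _ h) => W /= [[P Q]] /= [nP nQ] PQW.
suff : \forall x \near F, W (gmul (f x) (g x)) by [].
near=> x; apply: (PQW (f x, g x)).
  by split=> /=; near: x; [exact: fa|exact: gb].
by near: x.
Unshelve. all: by end_near.
Qed.

Lemma rng_continuous : continuous (@rng H).
Proof.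
move=> a; apply: (@gmul_cvg _ _ _ id ginv) => //.
- exact: composableV.
- exact: ginv_continuous.
- by near=> x; exact: composableV.
Unshelve. all: by end_near.
Qed.

Lemma src_continuous : continuous (@src H).
Proof.
move=> a; apply: (@gmul_cvg _ _ _ ginv id) => //.
- exact: composableVl.
- exact: ginv_continuous.
- by near=> x; exact: composableVl.
Unshelve. all: by end_near.
Qed.

End GroupoidAlgebra.

(** Compactness in the form of an induction: a property of sets that is local,
    hereditary and stable under unions of two sets holds of compact sets. If it
    failed for [K], the complements in [K] of the sets with the property would
    generate a proper filter without cluster point. *)
Lemma compact_ind (X : topologicalType) (Q : set X -> Prop) (K : set X) :
  compact K -> Q set0 -> (forall U V, Q U -> Q V -> Q (U `|` V)) ->
  (forall U V, U `<=` V -> Q V -> Q U) ->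
  (forall x, K x -> exists2 U, open_nbhs x U & Q U) -> Q K.
Proof.
move=> cK Q0 QU QS KQ; apply: contrapT => nQK.
pose F : set_system X := [set A | exists2 V, Q V & K `\` V `<=` A].
have FF : Filter F.
  split; first by exists set0.
  - move=> A B [U QU' UA] [V QV VB]; exists (U `|` V); first exact: QU.
    by move=> x [Kx /not_orP[nU nV]]; split; [exact: UA|exact: VB].
  - by move=> A B AB [U QU' UA]; exists U => //; exact: subset_trans AB.
have PF : ProperFilter F.
  split=> // -[V QV KV]; apply: nQK; apply: QS QV => x Kx.
  by apply: contrapT => nV; exact: (KV x).
have [|x [Kx Fx]] := cK F PF; first by exists set0 => // x [].
have [U oU QU'] := KQ x Kx.
have [|y [[_ nUy] Uy]] := Fx (K `\` U) U _ (open_nbhs_nbhs oU) => //.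
by exists U.
Qed.

Lemma open_locally (X : topologicalType) (A : set X) :
  (forall x, A x -> exists2 U, open_nbhs x U & U `<=` A) -> open A.
Proof.
move=> h; rewrite openE => x /h [U [oU Ux] UA].
by rewrite /interior /=; rewrite nbhsE; exists U.
Qed.

Section AmpleTopology.
Variable G : topGroupoid.
Hypotheses (G_ample : ample G) (G_haus : hausdorff_space G).
Implicit Types a b d : G.

Lemma ample_nbhs a (W : set G) : open_nbhs a W ->
  exists2 B, [/\ compact B, open_bisection B & B a] & B `<=` W.
Proof.
move=> [oW Wa]; have [_ /(_ a W)] := G_ample.
case; first by apply: open_nbhs_nbhs.
by move=> B [[cB bB] Ba] BW; exists B.
Qed.

Lemma open_rng (U : set G) : open U -> open (rng @` U).
Proof.
move=> oU; apply: open_locally => _ [a Ua <-].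
have [B [_ [_ oB _ _ _] Ba] BU] := ample_nbhs (conj oU Ua).
exists (rng @` B); first by split=> //; exists a.
exact: image_subset.
Qed.

Lemma open_src (U : set G) : open U -> open (src @` U).
Proof.
move=> oU; apply: open_locally => _ [a Ua <-].
have [B [_ [_ _ oB _ _] Ba] BU] := ample_nbhs (conj oU Ua).
exists (src @` B); first by split=> //; exists a.
exact: image_subset.
Qed.

Lemma open_unit_space : open (unit_space G).
Proof. by apply: open_src; exact: openT. Qed.

Lemma closed_eq_set (X : topologicalType) (f g : X -> G) :
  continuous f -> continuous g -> closed [set x | f x = g x].
Proof.
move=> cf cg; rewrite -openC; apply: open_locally => x /eqP fgx.
have := G_haus; rewrite open_hausdorff => /(_ _ _ fgx) [[U V]] /=.
rewrite !inE => -[Uf Vg] [oU oV UV].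
exists (f @^-1` U `&` g @^-1` V).
  split; last by split.
  by apply: openI; [move/continuousP: cf|move/continuousP: cg]; exact.
move=> y [/= Uy Vy] e; have : (U `&` V) (f y) by split=> //; rewrite e.
by rewrite UV.
Qed.

Lemma clopen_unit_space : clopen (unit_space G).
Proof.
split; first exact: open_unit_space.
have -> : unit_space G = [set x | rng x = x].
  by apply/seteqP; split=> x /unit_spaceE.
by apply: closed_eq_set; [exact: rng_continuous|move=> ?].
Qed.

Lemma compact_clopen (K : set G) : compact K -> open K -> clopen K.
Proof. by move=> cK oK; split=> //; exact: compact_closed. Qed.

Lemma compact_rng (K : set G) : compact K -> compact (rng @` K).
Proof.
by move=> cK; apply: continuous_compact => //;
   apply: continuous_subspaceT; exact: rng_continuous.
Qed.

Lemma compact_src (K : set G) : compact K -> compact (src @` K).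
Proof.
by move=> cK; apply: continuous_compact => //;
   apply: continuous_subspaceT; exact: src_continuous.
Qed.

Lemma bisection_rng_inj (B : set G) a b : open_bisection B -> B a -> B b ->
  rng a = rng b -> a = b.
Proof. by move=> [_ _ _ [[_ h _] _ _] _] Ba Bb; apply: h; rewrite inE. Qed.

Lemma bisection_src_inj (B : set G) a b : open_bisection B -> B a -> B b ->
  src a = src b -> a = b.
Proof. by move=> [_ _ _ _ [[_ h _] _ _]] Ba Bb; apply: h; rewrite inE. Qed.

(** A range fibre meets each bisection in at most one point, and finitely many
    bisections cover [K]. This makes the sums that define convolutions finite. *)
Lemma finite_rng_fibre (K : set G) (x : G) : compact K ->
  finite_set (K `&` [set a | rng a = x]).
Proof.
move=> cK; pose Q (V : set G) := finite_set (V `&` [set a | rng a = x]).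
apply: (@compact_ind _ Q) => //; rewrite /Q.
- by rewrite set0I.
- by move=> U V fU fV; rewrite setIUl finite_setU.
- by move=> U V UV; apply: sub_finite_set; exact: setSI.
move=> a Ka; have [B [_ bB Ba] _] := ample_nbhs (conj openT (I : setT a)).
exists B; first by case: bB.
have [-> //|/set0P[b [Bb bx]]] := eqVneq (B `&` [set a | rng a = x]) set0.
apply: sub_finite_set (finite_set1 b) => d [Bd dx].
by apply: (bisection_rng_inj bB Bd Bb); rewrite bx.
Qed.

(** Range and source are open maps on an ample groupoid, so injectivity is all
    that an open set needs to be a bisection. *)
Lemma injective_open_bisection (U : set G) : open U ->
  {in U &, injective rng} -> {in U &, injective src} -> open_bisection U.
Proof.
move=> oU ri si; split=> //; [exact: open_rng|exact: open_src| |].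
- split; first exact: inj_bij.
    by apply: continuous_subspaceT; exact: rng_continuous.
  move=> V oV; exists (rng @` (U `&` V)); first by apply/open_rng/openI.
  by apply/esym/setIidr/image_subset => x [].
- split; first exact: inj_bij.
    by apply: continuous_subspaceT; exact: src_continuous.
  move=> V oV; exists (src @` (U `&` V)); first by apply/open_src/openI.
  by apply/esym/setIidr/image_subset => x [].
Qed.

End AmpleTopology.

(** * The action of the units on a twist, and local sections *)

Section TwistAlgebra.
Variables (R : comUnitRingType) (G Sigma : topGroupoid) (T : twist R G Sigma).
Local Notation q := (tw_q T).
Local Notation i := (tw_i T).
Local Notation act := (tw_act T).
Implicit Types (a b s : Sigma) (t : units R) (x : G).

Lemma q_unit s : unit_space Sigma s -> unit_space G (q s).
Proof. by have [[h _ _] _ _] := tw_q_units T; exact: h. Qed.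

Lemma q_unit_inj a b : unit_space Sigma a -> unit_space Sigma b ->
  q a = q b -> a = b.
Proof. by have [[_ h _] _ _] := tw_q_units T => ua ub; apply: h; rewrite inE. Qed.

Lemma q_rng s : q (rng s) = rng (q s).
Proof.
have rs : composable (rng s) s by rewrite /composable src_rng.
by have [<- _] := tw_q_hom T rs; rewrite src_unit //; exact/q_unit/unit_rng.
Qed.

Lemma q_src s : q (src s) = src (q s).
Proof.
have ss : composable s (src s) by rewrite /composable rng_src.
by have [-> _] := tw_q_hom T ss; rewrite rng_unit //; exact/q_unit/unit_src.
Qed.

Lemma q_mul a b : composable a b -> q (gmul a b) = gmul (q a) (q b).
Proof. by case/(tw_q_hom T). Qed.

Lemma q_inv s : q (ginv s) = ginv (q s).
Proof.
have cs := composableV s; have [cqs _] := tw_q_hom T cs.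
by rewrite -[LHS](gmulKl cqs) -q_mul // gmulV q_rng -src_inv gmul_src.
Qed.

Lemma rng_eq_q a b : rng (q a) = rng (q b) -> rng a = rng b.
Proof. by move=> e; apply: q_unit_inj; rewrite ?q_rng //; exact: unit_rng. Qed.

Lemma src_eq_q a b : src (q a) = src (q b) -> src a = src b.
Proof. by move=> e; apply: q_unit_inj; rewrite ?q_src //; exact: unit_src. Qed.

Lemma composable_q a b : composable (q a) (q b) <-> composable a b.
Proof.
rewrite /composable -q_src -q_rng; split=> [e|-> //].
by apply: (q_unit_inj _ _ e); [exact: unit_src|exact: unit_rng].
Qed.

Lemma unit_q s : unit_space G (q s) -> exists t, s = i (q s) t.
Proof.
move=> us; have : (q @^-1` [set q s]) s by [].
by rewrite -(tw_fibre T us) => -[t _ e]; exists t.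
Qed.

Lemma qi x t : unit_space G x -> q (i x t) = x.
Proof.
move=> ux; have : range (i x) (i x t) by exists t.
by rewrite (tw_fibre T ux).
Qed.

Lemma i1_unit x : unit_space G x -> unit_space Sigma (i x 1%g).
Proof. by move=> ux; rewrite (tw_unit_space T); exists x. Qed.

Lemma i1_q s : unit_space Sigma s -> i (q s) 1%g = s.
Proof.
move=> us; have uq := q_unit us.
by apply: q_unit_inj; rewrite ?qi //; exact: i1_unit.
Qed.

Lemma src_i x t : unit_space G x -> src (i x t) = i x 1%g.
Proof.
move=> ux; have [-> _] := tw_i_hom T t 1%g ux.
by rewrite rng_unit //; exact: i1_unit.
Qed.

Lemma rng_i x t : unit_space G x -> rng (i x t) = i x 1%g.
Proof. by move=> ux; have [<- _] := tw_i_hom T 1%g t ux; rewrite src_i. Qed.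

Lemma act_composable t s : composable (i (q (rng s)) t) s.
Proof.
have ur : unit_space Sigma (rng s) := unit_rng s.
by rewrite /composable src_i ?i1_q //; exact: q_unit.
Qed.

Lemma rng_act t s : rng (act t s) = rng s.
Proof.
have ur : unit_space Sigma (rng s) := unit_rng s.
rewrite rng_mul; last exact: act_composable.
by rewrite rng_i ?i1_q //; exact: q_unit.
Qed.

Lemma src_act t s : src (act t s) = src s.
Proof. by rewrite src_mul //; exact: act_composable. Qed.

Lemma q_act t s : q (act t s) = q s.
Proof.
rewrite q_mul; last exact: act_composable.
by rewrite qi; [rewrite q_rng gmul_rng|exact/q_unit/unit_rng].
Qed.

Lemma act1 s : act 1%g s = s.
Proof. by rewrite /tw_act i1_q; [exact: gmul_rng|exact: unit_rng]. Qed.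

Lemma actM t t' s : act (t * t')%g s = act t (act t' s).
Proof.
have ur : unit_space G (q (rng s)) by exact/q_unit/unit_rng.
have [c e] := tw_i_hom T t t' ur.
by rewrite [RHS]/tw_act rng_act /tw_act e gmulA //; exact: act_composable.
Qed.

Lemma act_central t s : act t s = gmul s (i (q (src s)) t).
Proof. exact: tw_central. Qed.

Lemma act_mull t a b : composable a b -> gmul (act t a) b = act t (gmul a b).
Proof.
move=> ab; rewrite /tw_act rng_mul // gmulA //; exact: act_composable.
Qed.

Lemma act_mulr t a b : composable a b -> gmul a (act t b) = act t (gmul a b).
Proof.
move=> ab; rewrite -act_mull // [in RHS]act_central ab gmulA //
; last by have := act_composable t b.
have ub : unit_space Sigma (rng b) := unit_rng b.
by rewrite /composable rng_i ?i1_q //; exact: q_unit.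
Qed.

(** The quotient of [b] by [a] lies over a unit, where the fibre of [q] consists
    of the elements [tw_i x t]. *)
Lemma act_trans a b : q a = q b -> exists t, b = act t a.
Proof.
move=> ab; have sab : src b = src a by apply: src_eq_q; rewrite ab.
have rab : rng b = rng a by apply: rng_eq_q; rewrite ab.
have cab : composable b (ginv a) by rewrite /composable rng_inv.
have qab : q (gmul b (ginv a)) = q (rng a).
  by rewrite q_mul // q_inv -ab gmulV -q_rng.
have [|t e] := @unit_q (gmul b (ginv a)).
  by rewrite qab; exact/q_unit/unit_rng.
by exists t; rewrite /tw_act -qab -e gmulVKr.
Qed.

(** Composing with the inverse of [s] turns the action into [tw_i], which is
    injective. *)
Lemma act_inj t t' s : act t s = act t' s -> t = t'.
Proof.
move=> e; have ur : unit_space G (q (rng s)) by exact/q_unit/unit_rng.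
have : i (q (rng s)) t = i (q (rng s)) t'.
  by rewrite -(gmulKr (act_composable t s)) -[gmul _ s]/(act t s) e
    (gmulKr (act_composable t' s)).
by case/(tw_i_inj ur ur).
Qed.


Lemma act_ginv t s : ginv (act t s) = act t^-1%g (ginv s).
Proof.
have c : composable (act t s) (act t^-1%g (ginv s)).
  by rewrite /composable rng_act src_act rng_inv.
rewrite -[RHS](gmulKl c) act_mull; last by rewrite /composable rng_act rng_inv.
rewrite (act_mulr _ (composableV s)) -actM mulgV act1 gmulV -(rng_act t) -src_inv.
by rewrite gmul_src.
Qed.

(** The unit [t] with [b = t . a], for [a] and [b] in the same fibre of [q]. *)
(** The action is free, so for [a] and [b] in one fibre of [q] there is exactly
    one candidate; outside this case the value is the default 1. *)
Definition fibre_ratio a b : units R := xget 1%g [set t | b = act t a].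

Lemma act_ratio a b : q a = q b -> act (fibre_ratio a b) a = b.
Proof.
move=> /act_trans h; apply: esym.
exact: (@xgetPex _ 1%g [set t | b = act t a] h).
Qed.

Lemma ratio_act t a : fibre_ratio a (act t a) = t.
Proof. by apply/(@act_inj _ _ a)/act_ratio; rewrite q_act. Qed.

Lemma ratio_actr t a b : q a = q b -> fibre_ratio a (act t b) = (t * fibre_ratio a b)%g.
Proof. by move=> ab; rewrite -{1}(act_ratio ab) -actM ratio_act. Qed.

Lemma ratioM a b c : q a = q b -> q a = q c ->
  fibre_ratio b c = (fibre_ratio a c * (fibre_ratio a b)^-1)%g.
Proof.
move=> ab ac; apply: (@act_inj _ _ b); rewrite act_ratio -?ab //.
by rewrite -{2}(act_ratio ab) -actM mulgVK act_ratio.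
Qed.

(** Continuity is asked at each point, hence at the points of the ambient
    space: this is the usual notion when [B] is open. *)
Definition section_on (B : set G) (P : G -> Sigma) : Prop :=
  forall x, B x -> q (P x) = x /\ {for x, continuous P}.

Lemma section_onS (B B' : set G) P :
  B' `<=` B -> section_on B P -> section_on B' P.
Proof. by move=> BB' h b /BB' /h. Qed.

Lemma local_section x : exists (B : set G) (P : G -> Sigma),
  [/\ open_bisection B, B x & section_on B P].
Proof.
have [B [P [[bB Bx] cP qP _]]] := tw_local T x; exists B, P; split=> //.
move=> b Bb; split; first exact: qP.
by move: cP; rewrite (continuous_open_subspace P); [apply; rewrite inE|case: bB].
Qed.

Lemma q_continuous : continuous q. Proof. exact: tw_q_continuous. Qed.

Lemma open_q_preimage (U : set G) : open U -> open (q @^-1` U).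
Proof. by move: U; apply/continuousP; exact: q_continuous. Qed.

(** In a local trivialisation [q] is a product projection. *)
Lemma open_q (U : set Sigma) : open U -> open (q @` U).
Proof.
move=> oU; apply: open_locally => _ [s Us <-].
have [B' [P' [[bB' B's] cP' qP' [[_ _ hs] hc _]]]] := tw_local T (q s).
have [[x t] [/= B'x _] e] := hs s B's.
have xs : x = q s.
  rewrite -e q_mul ?qi ?qP' ?gmul_rng //; first exact: unit_rng.
  apply/composable_q; rewrite qi ?qP' //; last exact: unit_rng.
  by rewrite /composable src_rng.
have oB' : open B' by case: bB'.
move/subspace_continuousP: hc => /(_ (x, t)) hc.
have {hc} := hc (conj B'x I); rewrite within_interior; last first.
  apply: open_nbhs_nbhs; split; last by split.
  have -> : B' `*` setT = (@fst G (discrete_topology (units R))) @^-1` B'.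
    by apply/seteqP; split=> [[y u] []|[y u] By] //; split.
  by apply: open_comp => // p _; exact: fst_continuous.
move=> /(_ U) []; first by apply: open_nbhs_nbhs; split=> //; move: Us; rewrite -e.
move=> [/= V W] [nV nW] VW; have Wt := nbhs_singleton nW.
have : nbhs (q s) (V `&` B').
  by rewrite -xs; apply: filterI => //; exact: open_nbhs_nbhs.
rewrite nbhsE => -[V' oV' V'VB]; exists V' => // y /V'VB[Vy B'y].
have := VW (y, t) (conj Vy Wt) => /= Uy; exists (gmul (i (rng y) t) (P' y)) => //.
rewrite q_mul ?qi ?qP' ?gmul_rng //; first exact: unit_rng.
apply/composable_q; rewrite qi ?qP' //; last exact: unit_rng.
by rewrite /composable src_rng.
Qed.

(** Local triviality gives, near any point, some section along which coefficients
    are locally constant, the group of units being discrete. A coefficient along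
    another continuous section [P] is the quotient of two such coefficients,
    those of the point and of its image under [P]. *)
Lemma ratio_locally_constant (B : set G) P s : open B -> section_on B P ->
  B (q s) -> \forall a \near s, fibre_ratio (P (q a)) a = fibre_ratio (P (q s)) s.
Proof.
move=> oB secP Bs.
have [B' [P' [[bB' B's] cP' qP' [[hf _ hs] _ hop]]]] := tw_local T (q s).
have hE x t : B' x -> gmul (i (rng x) t) (P' x) = act t (P' x).
  by move=> B'x; rewrite /tw_act q_rng qP'.
(* near any point of q^-1 (B') the coefficient along P' is constant *)
have lc a0 : B' (q a0) ->
    \forall a \near a0, B' (q a) /\ fibre_ratio (P' (q a)) a = fibre_ratio (P' (q a0)) a0.
  move=> Ba0; set t0 := fibre_ratio _ _.
  have [|V oV VE] := hop ((@snd G (discrete_topology (units R))) @^-1` [set t0]).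
    by apply: open_comp => [p _|]; [exact: snd_continuous|exact: discrete_open].
  have : (q @^-1` B' `&` V) a0.
    rewrite -VE; exists (q a0, t0) => //=.
    by rewrite hE // act_ratio // qP'.
  move=> h0; have oh : open_nbhs a0 (q @^-1` B' `&` V).
    split=> //; apply: openI => //; apply: open_q_preimage.
    by case: bB'.
  move: (open_nbhs_nbhs oh); apply: filterS => a; rewrite -VE => -[[x t]].
  move=> [[/= B'x _] ->] <-; rewrite hE // q_act qP' //.
  by rewrite ratio_act.
have nq (V : set G) : nbhs (q s) V -> \forall a \near s, V (q a).
  exact: q_continuous.
have [qPs cPs] := secP _ Bs.
have near1 := lc s B's.
have near2 : \forall a \near s, B' (q (P (q a))) /\
    fibre_ratio (P' (q (P (q a)))) (P (q a)) = fibre_ratio (P' (q (P (q s)))) (P (q s)).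
  have c : (fun a => P (q a)) @ s --> P (q s).
    by apply: continuous_comp; [exact: q_continuous|].
  by apply: (c _ (lc (P (q s)) _)); rewrite qPs.
have near3 := nq _ (open_nbhs_nbhs (conj oB Bs)).
near=> a.
have [B'a ea] : B' (q a) /\ fibre_ratio (P' (q a)) a = fibre_ratio (P' (q s)) s.
  by near: a.
have [] : B' (q (P (q a))) /\
    fibre_ratio (P' (q (P (q a)))) (P (q a)) = fibre_ratio (P' (q (P (q s)))) (P (q s)).
  by near: a.
have Ba : B (q a) by near: a.
have [qPa _] := secP _ Ba; rewrite qPs qPa => _ e.
rewrite (@ratioM (P' (q a)) (P (q a)) a) ?qP' ?qPa // ea e.
by rewrite (@ratioM (P' (q s)) (P (q s)) s) ?qP' ?qPs.
Unshelve. all: by end_near.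
Qed.

Lemma unit_section : open (unit_space G) ->
  section_on (unit_space G) (fun x => i x 1%g).
Proof.
move=> oU x ux; split; first exact: qi.
have [_ ci _] := tw_i_units T; move: ci.
by rewrite (continuous_open_subspace _ oU); apply; rewrite inE.
Qed.

End TwistAlgebra.

(** * Functions of the twisted Steinberg algebra *)

Section SteinbergFunctions.
Variables (R : comUnitRingType) (G Sigma : topGroupoid) (T : twist R G Sigma).
Local Notation q := (tw_q T).
Local Notation i := (tw_i T).
Local Notation act := (tw_act T).
Implicit Types (a b s : Sigma) (t : units R) (x : G) (f g h : Sigma -> R^o).

Definition equivariant f := forall t s, f (act t s) = (val t)^-1 * f s.

Lemma val_unitV t : val (t^-1)%g = (val t)^-1. Proof. by []. Qed.

Lemma equivariant_ratio f a b : equivariant f -> q a = q b ->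
  f b = (val (fibre_ratio T a b))^-1 * f a.
Proof. by move=> ef ab; rewrite -ef act_ratio. Qed.

Lemma suppG_q f s : equivariant f -> suppG T f (q s) <-> f s != 0.
Proof.
move=> ef; split=> [[a fa e]|fs]; last by exists s.
apply: contra_neq fa => fs0.
by rewrite (equivariant_ratio ef (esym e)) fs0 mulr0.
Qed.

Lemma suppG_qN f s : equivariant f -> ~ suppG T f (q s) -> f s = 0.
Proof. by move=> ef ns; apply/eqP; apply: contra_notT ns => /suppG_q; apply. Qed.

Lemma suppG_exists f x : suppG T f x -> exists2 s, q s = x & f s != 0.
Proof. by move=> [s fs e]; exists s. Qed.

Lemma open_locally_constant f (A : set R) : locally_constant f ->
  open (f @^-1` A).
Proof.
move=> lf; rewrite openE => s As.
by apply: filterS (lf s) => b; rewrite /preimage /= => ->.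
Qed.

(** Equivariance makes the zero set of [f] a union of fibres of [q], so the
    support and the zero set have complementary images, both open. *)
Lemma suppG_clopen f : locally_constant f -> equivariant f ->
  clopen (suppG T f).
Proof.
move=> lf ef; split.
  by apply: open_q; exact: (@open_locally_constant f [set u | u != 0]).
have -> : suppG T f = ~` (q @` (f @^-1` [set 0])).
  apply/seteqP; split=> [_ [s fs <-] [a /= fa qa]|x nx].
    have /(suppG_q a ef) : suppG T f (q a) by rewrite qa; exists s.
    by rewrite fa eqxx.
  have : range q x by rewrite tw_q_surj.
  move=> [s _ sx]; exists s => //; apply: contra_notT nx => /negPn/eqP fs.
  by exists s.
by rewrite closedC; apply: open_q; exact: open_locally_constant.
Qed.

Lemma lc_continuous f : locally_constant f -> forall (X : topologicalType)
  (p : X -> Sigma) (x : X), p @ x --> p x ->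
  \forall y \near x, f (p y) = f (p x).
Proof. by move=> lf X p x cp; exact: cp _ (lf (p x)). Qed.

Lemma suppG0 : suppG T (0 : Sigma -> R^o) = set0.
Proof. by rewrite -subset0 => x [s] /=; rewrite /supp /= eqxx. Qed.

Lemma suppGD f g : suppG T (f + g) `<=` suppG T f `|` suppG T g.
Proof.
move=> _ [s fgs <-]; have [fs0|fs] := eqVneq (f s) 0; last by left; exists s.
by right; exists s => //; move: fgs; rewrite /supp /= /GRing.add /= fs0 add0r.
Qed.

Lemma suppGZ (u : R) f : suppG T (u *: f) `<=` suppG T f.
Proof.
move=> _ [s fs <-]; exists s => //; move: fs; apply: contra_neq => fs0.
by rewrite /GRing.scale /= fs0 scaler0.
Qed.

Lemma steinberg_zero : steinberg T 0.
Proof.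
split=> [s|t s|]; last by rewrite suppG0; exact: compact0.
- by near=> b.
- by rewrite mulr0.
Unshelve. all: by end_near.
Qed.

Lemma steinbergD f g : steinberg T f -> steinberg T g -> steinberg T (f + g).
Proof.
move=> [lf ef cf] [lg eg cg].
have lfg : locally_constant (f + g : Sigma -> R^o).
  move=> s; near=> b; rewrite /GRing.add /=; congr (_ + _).
    by near: b; exact: lf.
  by near: b; exact: lg.
have efg : equivariant (f + g).
  by move=> t s; rewrite /GRing.add /= ef eg mulrDr.
split=> //; apply: subclosed_compact (compactU cf cg) (@suppGD f g).
by case: (suppG_clopen lfg efg).
Unshelve. all: by end_near.
Qed.

Lemma steinbergZ (u : R) f : steinberg T f -> steinberg T (u *: f).
Proof.
move=> [lf ef cf].
have luf : locally_constant (u *: f : Sigma -> R^o).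
  by move=> s; near=> b; rewrite /GRing.scale /=; congr (_ *: _);
    near: b; exact: lf.
have euf : equivariant (u *: f).
  by move=> t s; rewrite /GRing.scale /= ef /GRing.scale /= mulrCA.
split=> //; apply: subclosed_compact cf (@suppGZ u f).
by case: (suppG_clopen luf euf).
Unshelve. all: by end_near.
Qed.

Definition cutoff (U : set G) f : Sigma -> R^o :=
  fun s => if q s \in U then f s else 0.

Lemma cutoff_in (U : set G) f s : U (q s) -> cutoff U f s = f s.
Proof. by move=> Us; rewrite /cutoff ifT // inE. Qed.

Lemma cutoff_out (U : set G) f s : ~ U (q s) -> cutoff U f s = 0.
Proof. by move=> Us; rewrite /cutoff ifF //; apply/negbTE; rewrite notin_setE. Qed.

Lemma suppG_cutoff (U : set G) f : suppG T (cutoff U f) = suppG T f `&` U.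
Proof.
apply/seteqP; split=> [_ [s fs <-]|_ [[s fs <-] Us]].
  move: fs; rewrite /supp /= /cutoff; case: ifPn => [|_]; last by rewrite eqxx.
  by rewrite inE => Us fs; split=> //; exists s.
by exists s => //; rewrite /supp /= cutoff_in.
Qed.

Lemma near_q (U : set G) s : open U -> U (q s) -> \forall b \near s, U (q b).
Proof.
by move=> oU Us; apply: (@q_continuous _ _ _ T s U);
  apply: open_nbhs_nbhs; split.
Qed.

Lemma cutoff_equivariant (U : set G) f : equivariant f -> equivariant (cutoff U f).
Proof.
move=> ef t s; rewrite /cutoff q_act; case: ifP => _; first exact: ef.
by rewrite mulr0.
Qed.

Lemma cutoff_locally_constant (U : set G) f : clopen U -> locally_constant f ->
  locally_constant (cutoff U f).
Proof.
move=> [oU cU] lf s; have [Us|nUs] := pselect (U (q s)).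
  near=> b; rewrite !cutoff_in //; first by near: b; exact: lf.
  by near: b; exact: near_q.
near=> b; rewrite !cutoff_out //.
by near: b; apply: (@near_q (~` U)) => //; rewrite openC.
Unshelve. all: by end_near.
Qed.

Lemma steinberg_cutoff (U : set G) f : clopen U -> steinberg T f ->
  steinberg T (cutoff U f).
Proof.
move=> oU [lf ef cf]; split.
- exact: cutoff_locally_constant.
- exact: cutoff_equivariant.
rewrite suppG_cutoff; apply: subclosed_compact cf _; last by move=> x [].
by apply: closedI; [case: (suppG_clopen lf ef)|case: oU].
Qed.

(** In the trivialisation of the twist over [U] that the section [P] gives,
    [chi U P] is the indicator function of [U]. *)
Definition chi (U : set G) (P : G -> Sigma) : Sigma -> R^o :=
  cutoff U (fun s => (val (fibre_ratio T (P (q s)) s))^-1 : R).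

Lemma chi_in (U : set G) P s : U (q s) ->
  chi U P s = (val (fibre_ratio T (P (q s)) s))^-1.
Proof. exact: cutoff_in. Qed.

Lemma chi_unit (U : set G) P s : U (q s) -> (chi U P s : R) \is a GRing.unit.
Proof. by move=> Us; rewrite chi_in // unitrV (valP (fibre_ratio _ _ _)). Qed.

Lemma chi_section (U : set G) P x : U x -> q (P x) = x -> chi U P (P x) = 1.
Proof.
move=> Ux qx; rewrite chi_in qx //.
by rewrite -[X in fibre_ratio _ _ X](act1 T) ratio_act invr1.
Qed.

Lemma suppG_chi (U : set G) P : suppG T (chi U P) = U.
Proof.
apply/seteqP; split=> [x|x Ux].
  by rewrite /chi suppG_cutoff => -[].
have : range q x by rewrite tw_q_surj.
move=> [s _ sx]; exists s => //; rewrite /supp /=.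
have : (chi U P s : R) \is a GRing.unit by apply: chi_unit; rewrite sx.
by apply: contraTneq => ->; rewrite unitr0.
Qed.

Lemma steinberg_chi (U : set G) P : open U -> closed U -> compact U ->
  section_on T U P -> steinberg T (chi U P).
Proof.
move=> oU clU cU secP; split; last by rewrite suppG_chi.
- move=> s; have [Us|nUs] := pselect (U (q s)).
    near=> b; rewrite !chi_in //; last by near: b; exact: near_q.
    congr (val _)^-1; near: b.
    exact: (ratio_locally_constant (B := U)).
  near=> b; rewrite /chi !cutoff_out //.
  by near: b; apply: (@near_q (~` U)) => //; rewrite openC.
- move=> t s; have [Us|nUs] := pselect (U (q s)); last first.
    by rewrite /chi !cutoff_out ?q_act ?mulr0.
  rewrite !chi_in ?q_act // ratio_actr; last by case: (secP _ Us).
  by rewrite /= invrM ?(valP t) ?(valP (fibre_ratio _ _ _)) // mulrC.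
Unshelve. all: by end_near.
Qed.

(** Small enough [U] make [f] constant along [P], which is how indicators arise
    from an arbitrary function. *)
Lemma cutoff_chi (U W : set G) P f s0 : equivariant f -> section_on T W P ->
  U `<=` W -> (forall x, U x -> f (P x) = f s0) ->
  cutoff U f = (f s0 : R) *: chi U P.
Proof.
move=> ef secP UW fP; apply/funext => s; rewrite /GRing.scale /=.
have [Us|nUs] := pselect (U (q s)); last by rewrite /chi !cutoff_out ?scaler0.
rewrite cutoff_in // chi_in // (equivariant_ratio ef (a := P (q s))); last first.
  by have [] := secP _ (UW _ Us).
by rewrite fP // /GRing.scale /= mulrC.
Qed.

End SteinbergFunctions.

(** * Generation by indicators of bisections, and convolution formulas *)

Section Induction.
Variables (R : comUnitRingType) (G Sigma : topGroupoid) (T : twist R G Sigma).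
Hypotheses (G_ample : ample G) (G_haus : hausdorff_space G).
Local Notation q := (tw_q T).

Lemma cutoff_split (U V : set G) (f : Sigma -> R^o) :
  cutoff T U f = cutoff T (U `&` V) f + cutoff T (U `\` V) f.
Proof.
apply/funext => s; rewrite /GRing.add /=.
have [Us|nUs] := pselect (U (q s)); last first.
  by rewrite !cutoff_out ?addr0 // => -[].
have [Vs|nVs] := pselect (V (q s)).
  by rewrite (cutoff_out (U := _ `\` _)) ?addr0 ?cutoff_in // => -[].
by rewrite (cutoff_out (U := _ `&` _)) ?add0r ?cutoff_in // => -[].
Qed.

(** The reduction to indicators. The caller chooses, near each arrow of the
    support, the section [P] and the neighbourhood [W] that bounds [U]: this is
    what produces homogeneous, diagonal or free pieces as needed. Cutting [f] to
    disjoint clopen sets splits it as a sum, and cutting it to a set on which it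
    is constant along [P] yields a multiple of an indicator. *)
Lemma steinberg_ind (Q : (Sigma -> R^o) -> Prop) (f : Sigma -> R^o) :
  steinberg T f -> Q 0 -> (forall g h, Q g -> Q h -> Q (g + h)) ->
  (forall x, suppG T f x -> exists (W : set G) (P : G -> Sigma),
    [/\ open_nbhs x W, section_on T W P &
      forall (t : R) U, compact U -> open U -> U `<=` W `&` suppG T f ->
        Q (t *: chi T U P)]) ->
  Q f.
Proof.
move=> [lf ef cf] Q0 QD Qloc; have clf := suppG_clopen lf ef.
pose K := suppG T f.
pose Q' (V : set G) := exists2 U : set G, clopen U /\ V `<=` U &
  forall V', clopen V' -> V' `<=` U -> V' `<=` K -> Q (cutoff T V' f).
have Q'K : Q' K.
  apply: compact_ind => //.
  - exists set0; first by split=> //; exact: clopen0.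
    move=> V' _ V'0 _; rewrite (_ : cutoff T V' f = 0) //.
    by apply/funext => s; rewrite cutoff_out // => /V'0.
  - move=> U V [U1 [cU1 UU1] QU] [V1 [cV1 VV1] QV].
    exists (U1 `|` V1); first by split; [exact: clopenU|exact: setUSS].
    move=> V' cV' V'UV V'K; rewrite (cutoff_split _ U1); apply: QD.
      apply: QU; [exact: clopenI|by move=> x []|by move=> x [/V'K]].
    apply: QV; [|by move=> x [/V'UV[]]|by move=> x [/V'K]].
    by rewrite setDE; apply: clopenI => //; exact: clopenC.
  - by move=> U V UV [W [cW VW] QW]; exists W => //; split=> // x /UV/VW.
  move=> x Kx; have [W [P [[oW Wx] secP Qt]]] := Qloc x Kx.
  have [qPx cPx] := secP _ Wx.
  have : nbhs x [set y | [/\ W y, K y & f (P y) = f (P x)]].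
    near=> y; split; near: y.
    - by apply: open_nbhs_nbhs; split.
    - by apply: open_nbhs_nbhs; split=> //; case: clf.
    - exact: lc_continuous.
  rewrite nbhsE => -[U0 oU0 U0P].
  have [B [cB [oB _ _ _ _] Bx] BU0] := ample_nbhs G_ample oU0.
  exists B; first by split.
  exists B; first by split=> //; exact: compact_clopen.
  move=> V' [oV' cV'] V'B V'K.
  rewrite (cutoff_chi (W := W) (P := P) (s0 := P x)) //.
  - apply: Qt => //; first exact: subclosed_compact V'B.
    by move=> y V'y; have [Wy Ky _] := U0P _ (BU0 _ (V'B _ V'y)).
  - by move=> y /V'B/BU0/U0P[].
  - by move=> y /V'B/BU0/U0P[].
case: Q'K => U [_ KU] /(_ K clf KU (fun x h => h)).
congr (Q _); apply/funext => s; have [Ks|nKs] := pselect (K (q s)).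
  by rewrite cutoff_in.
by rewrite cutoff_out // (suppG_qN ef nKs).
Unshelve. all: by end_near.
Qed.

End Induction.

Section ConvolutionFormulas.
Variables (R : comUnitRingType) (G Sigma : topGroupoid) (T : twist R G Sigma).
Local Notation q := (tw_q T).
Local Notation act := (tw_act T).
Implicit Types (a b s : Sigma) (t : units R) (x : G) (f g h : Sigma -> R^o).
Local Notation equivariant := (equivariant T).

(** The reason why convolution does not depend on the choice of a section: the
    unit that relates two elements of a fibre enters [f] and [g] inversely. *)
Lemma conv_term f g s a b : equivariant f -> equivariant g ->
  q a = q b -> rng (q a) = rng (q s) ->
  f a * g (gmul (ginv a) s) = f b * g (gmul (ginv b) s).
Proof.
move=> ef eg /act_trans[t ->] ras.
have c : composable (ginv a) s.
  by rewrite /composable src_inv; exact: (rng_eq_q (T := T)).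
rewrite act_ginv act_mull // ef eg val_unitV invrK mulrACA.
by rewrite mulVr ?mul1r // (valP t).
Qed.

(** The set [K] is free so that several convolutions can be written as sums over
    one index set. *)
Lemma convE (K : set G) (S : G -> Sigma) f g s :
  equivariant f -> equivariant g -> suppG T f `<=` K ->
  (forall x, rng x = rng (q s) -> q (S x) = x) ->
  conv T f g s = \sum_(x \in K `&` [set x | rng x = rng (q s)])
    f (S x) * g (gmul (ginv (S x)) s).
Proof.
move=> ef eg fK qS; rewrite /conv /conv_section q_rng.
transitivity (\sum_(x \in [set x | suppG T f x /\ rng x = rng (q s)])
    f (S x) * g (gmul (ginv (S x)) s)); last first.
  apply: fsbig_widen => [x [/fK Kx rx] //|x [[Kx rx] /= nfx]].
  suff -> : f (S x) = 0 by rewrite mul0r.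
  by apply: (suppG_qN ef); rewrite qS // => fx; exact: nfx.
apply: eq_fsbigr => x; rewrite inE /= => -[/suppG_exists[b bx fb] rx].
set b0 := xget _ _; have [_ qb0] : supp f b0 /\ q b0 = x.
  by apply: (@xgetPex _ s [set tau | supp f tau /\ q tau = x]); exists b.
by apply: conv_term => //; rewrite qb0 ?qS.
Qed.

Lemma global_section : exists S : G -> Sigma, forall x, q (S x) = x.
Proof.
have h x : exists s, q s = x.
  have : range q x by rewrite tw_q_surj.
  by case=> s _ <-; exists s.
by exists (fun x => sval (cid (h x))) => x; case: cid.
Qed.

Lemma conv_single f g s a : equivariant f -> equivariant g ->
  rng (q a) = rng (q s) ->
  (forall b, rng (q b) = rng (q s) -> q b <> q a ->
    f b * g (gmul (ginv b) s) = 0) ->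
  conv T f g s = f a * g (gmul (ginv a) s).
Proof.
move=> ef eg ras fg0; have [S qS] := global_section.
rewrite (convE (K := setT) (S := S)) // setTI.
rewrite -(fsbig_widen [set q a]).
- by rewrite fsbig_set1; apply: conv_term; rewrite ?qS.
- by move=> x ->.
- by move=> x [/= rx nx]; apply: fg0; rewrite qS.
Qed.

Lemma conv_zero f g s : equivariant f -> equivariant g ->
  (forall b, rng (q b) = rng (q s) -> f b * g (gmul (ginv b) s) = 0) ->
  conv T f g s = 0.
Proof.
move=> ef eg fg0; have [S qS] := global_section.
rewrite (convE (K := setT) (S := S)) // fsbig1 // => x [_ rx].
by apply: fg0; rewrite qS.
Qed.

Definition rng_injective (B : set G) :=
  forall x y, B x -> B y -> rng x = rng y -> x = y.

Definition src_injective (B : set G) :=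
  forall x y, B x -> B y -> src x = src y -> x = y.

Lemma conv_rng_injective (B : set G) f g s a : equivariant f ->
  equivariant g -> suppG T f `<=` B -> rng_injective B -> B (q a) ->
  rng (q a) = rng (q s) -> conv T f g s = f a * g (gmul (ginv a) s).
Proof.
move=> ef eg fB iB Ba ras; apply: conv_single => // b rbs nba.
have -> : f b = 0; last by rewrite mul0r.
apply: (suppG_qN ef) => /fB Bb; apply: nba; apply: iB => //.
by rewrite rbs.
Qed.

Lemma conv_src_injective (B : set G) f g s a : equivariant f ->
  equivariant g -> suppG T g `<=` B -> src_injective B -> B (q a) ->
  src (q a) = src (q s) -> conv T f g s = f (gmul s (ginv a)) * g a.
Proof.
move=> ef eg gB iB Ba sas.
have sas' : src a = src s by exact: src_eq_q sas.
have c : composable s (ginv a) by rewrite /composable rng_inv.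
have -> : g a = g (gmul (ginv (gmul s (ginv a))) s).
  by rewrite ginvM // ginvK gmulVKr.
apply: conv_single => // [|b rbs nba]; first by rewrite -!q_rng rng_mul.
have rbs' : rng b = rng s by exact: rng_eq_q rbs.
have cb : composable (ginv b) s by rewrite /composable src_inv.
have -> : g (gmul (ginv b) s) = 0; last by rewrite mulr0.
apply: (suppG_qN eg) => /gB Bb; apply: nba.
have e : q (gmul (ginv b) s) = q a.
  by apply: iB => //; rewrite -q_src src_mul // q_src.
have cs : composable s (ginv (gmul (ginv b) s)).
  by rewrite /composable rng_inv src_mul.
rewrite [RHS]q_mul; last by rewrite /composable rng_inv.
by rewrite q_inv -e -q_inv -q_mul // ginvM // ginvK gmulVKl.
Qed.

End ConvolutionFormulas.

(** * The convolution algebra *)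

Section ConvolutionAlgebra.
Variables (R : comUnitRingType) (G Sigma : topGroupoid) (T : twist R G Sigma).
Hypotheses (G_ample : ample G) (G_haus : hausdorff_space G).
Local Notation q := (tw_q T).
Local Notation act := (tw_act T).
Implicit Types (a b s : Sigma) (t : units R) (x : G) (f g h : Sigma -> R^o).
Local Notation equivariant := (equivariant T).
Local Notation "f ** g" := (conv T f g) (at level 40, left associativity).

Lemma addscaleE (t : R) f g s : (t *: f + g) s = t * f s + g s.
Proof. by []. Qed.

Lemma finite_fibre f s : steinberg T f ->
  finite_set (suppG T f `&` [set x | rng x = rng (q s)]).
Proof. by case=> _ _ cf; exact: finite_rng_fibre. Qed.

(** If no such pair existed, all terms of the convolution would vanish. *)
Lemma suppG_conv f g x : equivariant f -> equivariant g ->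
  suppG T (f ** g) x -> exists y z,
    [/\ suppG T f y, suppG T g z, composable y z & x = gmul y z].
Proof.
move=> ef eg [s fgs <-]; apply: contrapT => nyz; move: fgs.
rewrite /supp /= conv_zero ?eqxx // => b rbs.
apply/eqP; apply: contra_notT nyz => fgb.
have rbs' : rng b = rng s by exact: rng_eq_q rbs.
exists (q b), (q (gmul (ginv b) s)); split.
- by apply/suppG_q => //; apply: contra_neq fgb => ->; rewrite mul0r.
- by apply/suppG_q => //; apply: contra_neq fgb => ->; rewrite mulr0.
- by apply/composable_q; rewrite /composable rng_mul ?rng_inv ?/composable
    ?src_inv.
- by rewrite -q_mul ?gmulVKl // /composable rng_mul ?rng_inv ?/composable
    ?src_inv.
Qed.

Lemma convDZl (t : R) f1 f2 g : steinberg T f1 -> steinberg T f2 ->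
  equivariant g -> (t *: f1 + f2) ** g = t *: (f1 ** g) + f2 ** g.
Proof.
move=> A1 A2 eg; have [S qS] := global_section T.
have [_ e1 c1] := A1; have [_ e2 c2] := A2.
have [_ e12 _] : steinberg T (t *: f1 + f2).
  by apply: steinbergD => //; exact: steinbergZ.
pose K := suppG T f1 `|` suppG T f2.
have K12 : suppG T (t *: f1 + f2) `<=` K.
  by apply: subset_trans (@suppGD _ _ _ T _ _) _; apply: setSU; exact: suppGZ.
have K1 : suppG T f1 `<=` K by left.
have K2 : suppG T f2 `<=` K by right.
apply/funext => s; rewrite addscaleE !(convE (K := K) (S := S)) //.
have fK : finite_set (K `&` [set x | rng x = rng (q s)]).
  by apply: finite_rng_fibre => //; exact: compactU.
rewrite !fsbig_finite // mulr_sumr -big_split; apply: eq_bigr => x _.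
by rewrite addscaleE mulrDl mulrA.
Qed.

Lemma conv0l g : equivariant g -> 0 ** g = 0.
Proof.
move=> eg; have [_ e0 _] := steinberg_zero T.
by apply/funext => s; rewrite conv_zero // => b _; rewrite mul0r.
Qed.

Lemma convDZr (t : R) f g1 g2 : steinberg T f -> equivariant g1 ->
  equivariant g2 -> f ** (t *: g1 + g2) = t *: (f ** g1) + f ** g2.
Proof.
move=> Af e1 e2; have [S qS] := global_section T; have [_ ef cf] := Af.
have e12 : equivariant (t *: g1 + g2).
  by move=> u s; rewrite !addscaleE e1 e2 mulrDr mulrCA.
apply/funext => s; rewrite addscaleE.
rewrite !(convE (K := suppG T f) (S := S)) //.
rewrite !fsbig_finite; try exact: finite_fibre.
rewrite mulr_sumr -big_split; apply: eq_bigr => x _.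
by rewrite addscaleE mulrDr mulrCA.
Qed.

Lemma conv_equivariant f g : steinberg T f -> equivariant g ->
  equivariant (f ** g).
Proof.
move=> Af eg t s; have [S qS] := global_section T; have [_ ef cf] := Af.
rewrite !(convE (K := suppG T f) (S := S)) //.
rewrite q_act !fsbig_finite; try exact: finite_fibre.
rewrite mulr_sumr; apply: eq_big_seq => x; rewrite in_fset_set; last exact: finite_fibre.
rewrite inE => -[_ /= rx].
rewrite act_mulr ?eg 1?mulrCA // /composable src_inv.
by apply: (rng_eq_q (T := T)); rewrite qS.
Qed.

(** Over [U] the only arrow [x] that contributes at [a] is the one whose range is
    that of [q a]. It depends continuously on [a], range being a homeomorphism
    on [U]; hence so do [P x] and the element at which [g] is evaluated. Away
    from the compact, hence closed, set of ranges of the support of [f] the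
    product vanishes. *)
Lemma conv_locally_constant_local (U : set G) P f g : open U ->
  rng_injective U -> section_on T U P -> steinberg T f -> suppG T f `<=` U ->
  locally_constant g -> equivariant g -> locally_constant (f ** g).
Proof.
move=> oU iU secP Af fU lg eg s; have [lf ef cf] := Af.
have qsc : {for s, continuous (fun a => rng (q a))}.
  by apply: continuous_comp; [exact: q_continuous|exact: rng_continuous].
have nrng (V : set G) : open V -> V (rng (q s)) ->
    \forall a \near s, V (rng (q a)).
  by move=> oV Vs; apply: (qsc V); apply: open_nbhs_nbhs; split.
have [[x fx rx]|nx] := pselect (exists2 x, suppG T f x & rng x = rng (q s));
    last first.
  have fgz a : ~ (rng @` suppG T f) (rng (q a)) -> (f ** g) a = 0.
    move=> na; apply: conv_zero => // b rb.
    have -> : f b = 0; last by rewrite mul0r.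
    by apply: (suppG_qN ef) => fb; apply: na; exists (q b).
  have ns : ~ (rng @` suppG T f) (rng (q s)) by move=> [x fx rx]; apply: nx; exists x.
  near=> a; rewrite !fgz //; near: a.
  apply: (nrng (~` (rng @` suppG T f))) => //; rewrite openC.
  by apply: compact_closed => //; exact: compact_rng.
have Ux := fU x fx.
pose beta a := xget x [set y | U y /\ rng y = rng (q a)].
have betaE a y : U y -> rng y = rng (q a) -> beta a = y.
  move=> Uy ry; have [Ub rb] : [set y | U y /\ rng y = rng (q a)] (beta a).
    by apply: xgetPex; exists y.
  by apply: iU => //; rewrite rb.
have near_beta (V : set G) : open V -> V x ->
    \forall a \near s, [/\ U (beta a), V (beta a) & rng (beta a) = rng (q a)].
  move=> oV Vx; have : \forall a \near s, (rng @` (U `&` V)) (rng (q a)).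
    apply: nrng; first by apply: open_rng => //; exact: openI.
    by exists x.
  by apply: filterS => a [y [Uy Vy] ry]; rewrite (betaE a y).
have beta_s : beta s = x by exact: betaE.
have beta_cvg : beta @ s --> x.
  move=> V; rewrite nbhsE => -[V' [oV' V'x] V'V].
  by apply: filterS (near_beta V' oV' V'x) => a [_ /V'V].
have [qPx cPx] := secP x Ux.
have P_cvg : (fun a => P (beta a)) @ s --> P x by apply: cvg_comp beta_cvg cPx.
have sE a : U (beta a) -> rng (beta a) = rng (q a) ->
    (f ** g) a = f (P (beta a)) * g (gmul (ginv (P (beta a))) a).
  move=> Ub rb; have [qPb _] := secP _ Ub.
  by apply: (conv_rng_injective (B := U)); rewrite ?qPb.
have comp_s a : U (beta a) -> rng (beta a) = rng (q a) ->
    composable (ginv (P (beta a))) a.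
  move=> Ub rb; have [qPb _] := secP _ Ub.
  by rewrite /composable src_inv; apply: (rng_eq_q (T := T)); rewrite qPb.
have prod_cvg : (fun a => gmul (ginv (P (beta a))) a) @ s -->
    gmul (ginv (P x)) s.
  apply: (@gmul_cvg _ _ (nbhs s) _ (fun a => ginv (P (beta a))) id) => //.
  - by rewrite -beta_s; apply: comp_s; rewrite beta_s.
  - by apply: cvg_comp P_cvg _; exact: ginv_continuous.
  - by apply: filterS (near_beta setT openT I) => a [Ub _ rb]; exact: comp_s.
have near_f := P_cvg _ (lf (P x)).
have near_g := prod_cvg _ (lg (gmul (ginv (P x)) s)).
have near_b := near_beta setT openT I.
near=> a.
have [Ub _ rb] : [/\ U (beta a), setT (beta a) & rng (beta a) = rng (q a)].
  by near: a.
rewrite !sE ?beta_s //; congr (_ * _); near: a.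
- exact: near_f.
- exact: near_g.
Unshelve. all: by end_near.
Qed.

Lemma conv_locally_constant f g : steinberg T f -> steinberg T g ->
  locally_constant (f ** g).
Proof.
move=> Af [lg eg _].
suff [] : steinberg T f /\ locally_constant (f ** g) by [].
apply: (steinberg_ind G_ample G_haus (Q := fun f =>
  steinberg T f /\ locally_constant (f ** g)) Af).
- split; first exact: steinberg_zero.
  by rewrite conv0l //; have [] := steinberg_zero T.
- move=> f1 f2 [A1 l1] [A2 l2]; split; first exact: steinbergD.
  have := @convDZl 1 f1 f2 g A1 A2 eg; rewrite !scale1r => -> s.
  near=> a; rewrite /GRing.add /=; congr (_ + _); near: a; [exact: l1|exact: l2].
- move=> x fx; have [B [P [bB Bx secP]]] := local_section T x.
  have oB : open B by case: bB.
  exists B, P; split=> // t U cU oU UBf.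
  have secU : section_on T U P by apply: section_onS secP => y /UBf[].
  have AU : steinberg T (t *: chi T U P).
    by apply/steinbergZ/steinberg_chi => //; exact: compact_closed.
  split=> //; apply: (conv_locally_constant_local (U := B) (P := P)) => //.
    by move=> y z By Bz; exact: (bisection_rng_inj bB).
  by move=> y /suppGZ; rewrite suppG_chi => /UBf[].
Unshelve. all: by end_near.
Qed.

(** The support is closed and lies in the image under the product map of a
    closed part of the compact product of the two supports. *)
Lemma steinberg_conv f g : steinberg T f -> steinberg T g ->
  steinberg T (f ** g).
Proof.
move=> Af Ag; have [_ ef cf] := Af; have [_ eg cg] := Ag.
have lfg := conv_locally_constant Af Ag.
have efg := conv_equivariant Af eg.
split=> //.
pose D := (suppG T f `*` suppG T g) `&`
  [set p : G * G | src p.1 = rng p.2].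
apply: (@subclosed_compact _ _ ((fun p => gmul p.1 p.2) @` D)).
- by case: (suppG_clopen lfg efg).
- apply: continuous_compact.
    by apply: continuous_subspaceW (@gmul_continuous G) => p [].
  apply: (@subclosed_compact _ _ (suppG T f `*` suppG T g)); last by move=> p [].
    apply: closedI.
      have -> : suppG T f `*` suppG T g =
          (@fst G G) @^-1` suppG T f `&` (@snd G G) @^-1` suppG T g by [].
      by apply: closedI; apply: preimage_closed;
        try exact: compact_closed; move=> p _;
        [exact: fst_continuous|exact: snd_continuous].
    apply: closed_eq_set => //; apply: comp_continuous.
    + exact: fst_continuous.
    + exact: src_continuous.
    + exact: snd_continuous.
    + exact: rng_continuous.
  exact: compact_setX.
move=> x /(suppG_conv ef eg)[y [z [fy gz yz ->]]].
by exists (y, z).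
Qed.

(** For [f] supported on [B], a value of [f ** k] is a fixed multiple of a value
    of [k] translated by one element [tau]; what is left is that translation by
    [tau] permutes the terms of the convolution of [g] and [h]. *)
Lemma convA_local (B : set G) f g h : steinberg T f -> steinberg T g ->
  steinberg T h -> suppG T f `<=` B -> rng_injective B ->
  (f ** g) ** h = f ** (g ** h).
Proof.
move=> Af Ag Ah fB iB; have [_ ef _] := Af; have [_ eg _] := Ag.
have [_ eh _] := Ah.
have efg := conv_equivariant Af eg; have egh := conv_equivariant Ag eh.
apply/funext => s.
have [[x Bx rx]|nx] := pselect (exists2 x, B x & rng x = rng (q s));
    last first.
  have nf b : rng (q b) = rng (q s) -> f b = 0.
    move=> rb; apply: (suppG_qN ef) => /fB Bb; apply: nx.
    by exists (q b).
  rewrite [RHS]conv_zero //; last by move=> b rb; rewrite nf ?mul0r.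
  apply: conv_zero => // b rb.
  rewrite conv_zero ?mul0r // => b' rb'.
  by rewrite nf ?mul0r // rb' rb.
have [S qS] := global_section T.
pose tau := S x; have qtau : q tau = x by exact: qS.
have ctau : composable (ginv tau) s.
  by rewrite /composable src_inv; apply: (rng_eq_q (T := T)); rewrite qtau.
rewrite [RHS](conv_rng_injective (B := B) (a := tau)) ?qtau //.
rewrite [in RHS](convE (K := setT) (S := S)) // setTI.
rewrite full_fsbig_distrr; last first.
  apply: sub_finite_set (finite_fibre (gmul (ginv tau) s) Ag).
  move=> y [/= ry gy]; split=> //; apply: contrapT => ngy; apply: gy.
  by rewrite (suppG_qN eg) ?mul0r // qS.
pose S' y := gmul tau (S (gmul (ginv x) y)).
have rxs : rng (q (gmul (ginv tau) s)) = src x.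
  by rewrite q_mul // rng_mul ?q_inv ?qtau ?rng_inv // /composable src_inv.
rewrite rxs.
have cS y : rng y = src x -> composable tau (S y).
  by move=> ry; apply/(composable_q T); rewrite qtau qS.
rewrite (convE (K := setT) (S := S')) // ?setTI; last first.
  move=> y ry; rewrite /S' q_mul ?qtau ?qS ?gmulVKl ?rx //.
  by apply: cS; rewrite rng_mul ?rng_inv // /composable src_inv rx.
rewrite (reindex_fsbig (gmul x) [set y | rng y = src x]).
  apply: eq_fsbigr => y; rewrite inE /= => ry.
  have cy := cS y ry.
  rewrite /S' gmulKl; last by rewrite /composable ry.
  rewrite (conv_rng_injective (B := B) (a := tau)) ?qtau //; last first.
    by rewrite -!q_rng rng_mul // q_rng qtau.
  rewrite gmulKl // ginvM // gmulA ?mulrA // /composable src_inv ?rng_inv //.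
split.
- by move=> y /= ry; rewrite rng_mul // /composable ry.
- move=> y z; rewrite !inE /= => ry rz e.
  by rewrite -(@gmulKl _ x y) ?e ?gmulKl // /composable ?ry ?rz.
- move=> y /= ry; exists (gmul (ginv x) y).
    by rewrite /= rng_mul ?rng_inv // /composable src_inv rx.
  by rewrite gmulVKl // rx.
Qed.

Lemma convA f g h : steinberg T f -> steinberg T g -> steinberg T h ->
  (f ** g) ** h = f ** (g ** h).
Proof.
move=> Af Ag Ah; have [_ eg _] := Ag; have [_ eh _] := Ah.
have Agh := steinberg_conv Ag Ah; have [_ egh _] := Agh.
suff [] : steinberg T f /\ (f ** g) ** h = f ** (g ** h) by [].
apply: (steinberg_ind G_ample G_haus (Q := fun f =>
  steinberg T f /\ (f ** g) ** h = f ** (g ** h)) Af).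
- split; first exact: steinberg_zero.
  apply: (@convA_local set0) => //; first exact: steinberg_zero.
  by rewrite suppG0.
- move=> f1 f2 [A1 e1] [A2 e2]; split; first exact: steinbergD.
  rewrite -[f1]scale1r !convDZl ?e1 ?e2 //.
  + exact: steinberg_conv.
  + exact: steinberg_conv.
- move=> x fx; have [B [P [bB Bx secP]]] := local_section T x.
  have oB : open B by case: bB.
  exists B, P; split=> // t U cU oU UBf.
  have secU : section_on T U P by apply: section_onS secP => y /UBf[].
  have AU : steinberg T (t *: chi T U P).
    by apply/steinbergZ/steinberg_chi => //; exact: compact_closed.
  split=> //; apply: (@convA_local B) => //.
    by move=> y /suppGZ; rewrite suppG_chi => /UBf[].
  by move=> y z By Bz; exact: (bisection_rng_inj bB).
Qed.


End ConvolutionAlgebra.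

(** * Products of normalisers in an abstract pair *)

Section AbstractPairs.
Variables (R : comUnitRingType) (V : lmodType R) (mul : V -> V -> V).
Implicit Types X C S : set V.
Local Notation "a ** b" := (mul a b) (at level 40, left associativity).

Lemma lin_span0 S : lin_span S 0.
Proof. by exists [::]; split=> //; rewrite big_nil. Qed.

Lemma lin_spanD S u v : lin_span S u -> lin_span S v -> lin_span S (u + v).
Proof.
move=> [s [sS ->]] [r [rS ->]]; exists (s ++ r); split; last by rewrite big_cat.
by move=> p; rewrite mem_cat => /orP[/sS|/rS].
Qed.

Lemma lin_spanZ S (t : R) v : S v -> lin_span S (t *: v).
Proof.
move=> Sv; exists [:: (t, v)]; split; last by rewrite big_seq1.
by move=> p; rewrite inE => /eqP->.
Qed.

Lemma lin_span_sub S X : is_submodule X -> S `<=` X -> lin_span S `<=` X.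
Proof.
move=> [X0 XD XZ] SX v [s [sS ->]]; rewrite big_seq.
by elim/big_ind: _ => // p /sS/SX Xp; exact: XZ.
Qed.

Lemma lin_spanS S S' : S `<=` S' -> lin_span S `<=` lin_span S'.
Proof. by move=> SS v [s [sS ->]]; exists s; split=> // p /sS/SS. Qed.

Variables X C : set V.
Hypotheses (algX : is_algebra mul X) (comC : commutative_subalgebra mul X C).
Hypothesis luC : local_units mul X C.

Let XM a b : X a -> X b -> X (a ** b).
Proof. by case: algX => _ h _ _ _; exact: h. Qed.
Let XA a b c : X a -> X b -> X c -> (a ** b) ** c = a ** (b ** c).
Proof. by case: algX => _ _ h _ _; exact: h. Qed.
Let CX a : C a -> X a. Proof. by case: comC => h _ _ _; exact: h. Qed.

(** A local unit [e] of [m] puts [n m = n e m] in [n C m]. *)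
Lemma normaliser_mul_inv n m : normaliser_pair mul X C n m ->
  C (n ** m) /\ C (m ** n).
Proof.
move=> [[Xn Xm] _ _ nCm].
have [|a|e [Ce _] he] := luC (F := [set m; n]); first exact: finite_set2.
  by move=> [->|->].
have [|em _] := he m; first by left.
have [|en _] := he n; first by right.
have Xe := CX Ce; have [Cmn Cnm] := nCm e Ce.
by split; [rewrite -em|rewrite -en]; rewrite -XA.
Qed.

(** The products [m ** n] and [n' ** m'] lie in [C], so they commute; this is
    what lets the two factors be cancelled separately. *)
Lemma normalisersM n n' m m' : normaliser_pair mul X C n m ->
  normaliser_pair mul X C n' m' -> normaliser_pair mul X C (n ** n') (m' ** m).
Proof.
move=> Nn Nn'; have [Cnm Cmn] := normaliser_mul_inv Nn.
have [Cnm' Cmn'] := normaliser_mul_inv Nn'.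
have [_ _ _ comm] := comC.
have [[Xn Xm] mnm nmn nCm] := Nn; have [[Xn' Xm'] mnm' nmn' nCm'] := Nn'.
have Xnn := XM Xn Xn'; have Xmm := XM Xm' Xm.
have Xmn := XM Xm Xn; have Xnm' := XM Xn' Xm'.
split=> //.
- transitivity (m' ** ((m ** n) ** (n' ** m')) ** m).
    by rewrite !XA //; do ?apply: XM.
  rewrite [(m ** n) ** _]comm //; transitivity ((m' ** n' ** m') ** (m ** n ** m)).
    by rewrite !XA //; do ?apply: XM.
  by rewrite mnm' mnm.
- transitivity (n ** ((n' ** m') ** (m ** n)) ** n').
    by rewrite !XA //; do ?apply: XM.
  rewrite [(n' ** m') ** _]comm //; transitivity ((n ** m ** n) ** (n' ** m' ** n')).
    by rewrite !XA //; do ?apply: XM.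
  by rewrite nmn nmn'.
- move=> c Cc; have Xc := CX Cc; split.
  + have [h _] := nCm c Cc; have [h' _] := nCm' _ h.
    suff -> : m' ** m ** c ** (n ** n') = m' ** (m ** c ** n) ** n' by [].
    by rewrite !XA //; do ?apply: XM.
  + have [_ h] := nCm' c Cc; have [_ h'] := nCm _ h.
    suff -> : n ** n' ** c ** (m' ** m) = n ** (n' ** c ** m') ** m by [].
    by rewrite !XA //; do ?apply: XM.
Qed.

End AbstractPairs.

(** * The diagonal subalgebra and its conditional expectation *)

Section DiagonalSubalgebra.
Variables (R : comUnitRingType) (G Sigma : topGroupoid) (T : twist R G Sigma).
Hypotheses (G_ample : ample G) (G_haus : hausdorff_space G).
Local Notation q := (tw_q T).
Local Notation act := (tw_act T).
Implicit Types (a b s u : Sigma) (t : units R) (x : G) (c e f g h : Sigma -> R^o).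
Local Notation equivariant := (equivariant T).
Local Notation "f ** g" := (conv T f g) (at level 40, left associativity).
Local Notation A := (steinberg T).
Local Notation C := (steinberg_diag T).

Definition steinberg_on (Z : set G) : set (Sigma -> R^o) :=
  [set f | A f /\ suppG T f `<=` Z].

Lemma steinberg_onS (Z Z' : set G) : Z `<=` Z' ->
  steinberg_on Z `<=` steinberg_on Z'.
Proof. by move=> ZZ f [Af fZ]; split=> //; exact: subset_trans ZZ. Qed.

Lemma steinberg_on_submodule (Z : set G) : is_submodule (steinberg_on Z).
Proof.
split.
- by split; [exact: steinberg_zero|rewrite suppG0].
- move=> f g [Af fZ] [Ag gZ]; split; first exact: steinbergD.
  by move=> x /suppGD[/fZ|/gZ].
- move=> t f [Af fZ]; split; first exact: steinbergZ.
  by move=> x /suppGZ/fZ.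
Qed.

Lemma conv_diag_l c f s : C c -> equivariant f -> (c ** f) s = c (rng s) * f s.
Proof.
move=> [[_ ec _] cU] ef.
rewrite (conv_rng_injective (B := unit_space G) (a := rng s)) //.
- by rewrite ginv_unit ?gmul_rng //; exact: unit_rng.
- by move=> x y /rng_unit rx /rng_unit ry; rewrite rx ry.
- exact/q_unit/unit_rng.
- by rewrite -!q_rng rng_rng.
Qed.

Lemma conv_diag_r c f s : C c -> equivariant f -> (f ** c) s = f s * c (src s).
Proof.
move=> [[_ ec _] cU] ef.
rewrite (conv_src_injective (B := unit_space G) (a := src s)) //.
- by rewrite ginv_unit ?gmul_src //; exact: unit_src.
- by move=> x y /src_unit rx /src_unit ry; rewrite rx ry.
- exact/q_unit/unit_src.
- by rewrite -!q_src src_src.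
Qed.

Lemma diag_rng c s : C c -> c s != 0 -> rng s = src s /\ c (rng s) != 0.
Proof.
move=> [[_ ec _] cU] cs; have us : unit_space G (q s) by apply: cU; exists s.
have e : q (rng s) = q s by rewrite q_rng rng_unit.
split; first by apply: (q_unit_inj (T := T)); [exact: unit_rng|exact: unit_src|
  rewrite q_rng q_src rng_unit // src_unit].
by apply/(suppG_q (T := T)) => //; rewrite e; apply/suppG_q.
Qed.

Lemma diagM c d : C c -> C d -> C (c ** d).
Proof.
move=> [Ac cU] [Ad dU]; split; first exact: steinberg_conv.
have [_ ec _] := Ac; have [_ ed _] := Ad.
move=> _ /(suppG_conv ec ed)[y [z [/cU uy /dU uz cyz ->]]].
have -> : y = z by rewrite -(src_unit uy) cyz rng_unit.
by rewrite -{1}[z](rng_unit uz) gmul_rng.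
Qed.

Lemma diagC c d : C c -> C d -> c ** d = d ** c.
Proof.
move=> Cc Cd; have [[_ ec _] _] := Cc; have [[_ ed _] _] := Cd.
apply/funext => s; rewrite conv_diag_l // conv_diag_r //.
have [ds|/diag_rng-/(_ Cd)[-> _]] := eqVneq (d s) 0; last by rewrite mulrC.
by rewrite ds mulr0 mul0r.
Qed.

Definition indicator (K : set G) : Sigma -> R^o :=
  chi T K (fun x => tw_i T x 1%g).

Lemma indicator_diag (K : set G) : K `<=` unit_space G -> open K -> compact K ->
  C (indicator K).
Proof.
move=> KU oK cK; split; last by rewrite suppG_chi.
apply: steinberg_chi => //; first exact: compact_closed.
by apply: (section_onS KU); apply: unit_section; exact: open_unit_space.
Qed.

Lemma indicator_in (K : set G) u : unit_space Sigma u -> K (q u) ->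
  indicator K u = 1.
Proof.
move=> uu Ku; have qi1 : q (tw_i T (q u) 1%g) = q u by rewrite i1_q.
rewrite -[X in indicator K X](i1_q T uu).
exact: (@chi_section _ _ _ T K (fun x => tw_i T x 1%g)).
Qed.

Lemma indicator_out (K : set G) s : ~ K (q s) -> indicator K s = 0.
Proof. exact: cutoff_out. Qed.

Lemma indicator_idempotent (K : set G) : K `<=` unit_space G -> open K ->
  compact K -> idempotents (conv T) C (indicator K).
Proof.
move=> KU oK cK; have CK := indicator_diag KU oK cK; split=> //.
have [[_ eK _] _] := CK.
apply/funext => s; rewrite conv_diag_l //.
have [Ks|nKs] := pselect (K (q s)); last by rewrite (@indicator_out K s) ?mulr0.
rewrite indicator_in ?mul1r //; first exact: unit_rng.
by rewrite q_rng rng_unit //; exact: KU.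
Qed.

(** The sources and the ranges of finitely many supports form a compact open set
    of units, whose indicator fixes the given functions on both sides. *)
Lemma local_units_steinberg : local_units (conv T) A C.
Proof.
move=> F finF FA.
pose K := \bigcup_(f in F) (rng @` suppG T f `|` src @` suppG T f).
have cK : compact K.
  have [r rF] := (finite_seqP F).1 finF.
  rewrite /K rF bigcup_seq big_seq; apply: bigsetU_compact => f fr.
  have [_ _ cf] : A f by apply: FA; rewrite rF.
  by apply: compactU; [exact: compact_rng|exact: compact_src].
have oK : open K.
  apply: bigcup_open => f /FA[lf ef _]; have [of_ _] := suppG_clopen lf ef.
  by apply: openU; [exact: open_rng|exact: open_src].
have KU : K `<=` unit_space G.
  by move=> x [f _ [[y _ <-]|[y _ <-]]]; [exact: unit_rng|exact: unit_src].
exists (indicator K); first exact: indicator_idempotent.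
have CK := indicator_diag KU oK cK.
move=> f Ff; have [lf ef _] := FA f Ff; split; apply/funext => s.
  rewrite conv_diag_l //; have [->|fs] := eqVneq (f s) 0; first by rewrite mulr0.
  rewrite indicator_in ?mul1r //; first exact: unit_rng.
  by exists f => //; left; exists (q s); rewrite ?q_rng //; exists s.
rewrite conv_diag_r //; have [->|fs] := eqVneq (f s) 0; first by rewrite mul0r.
rewrite indicator_in ?mulr1 //; first exact: unit_src.
by exists f => //; right; exists (q s); rewrite ?q_src //; exists s.
Qed.

Lemma span_steinberg (Z : set G) (N : set (Sigma -> R^o)) :
  (forall x, Z x -> exists (W : set G) (P : G -> Sigma),
    [/\ open_nbhs x W, section_on T W P & forall U, compact U -> open U ->
      U `<=` W `&` Z -> N (chi T U P)]) ->
  steinberg_on Z `<=` lin_span N.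
Proof.
move=> locN f [Af fZ]; apply: (steinberg_ind G_ample G_haus Af).
- exact: lin_span0.
- exact: lin_spanD.
- move=> x /fZ/locN[W [P [oW secP NP]]]; exists W, P; split=> // t U cU oU UW.
  by apply/lin_spanZ/NP => // y /UW[Wy /fZ].
Qed.

(** Over units the canonical section [tw_i x 1] exists, and its indicators are
    the idempotents. *)
Lemma diag_span : C = lin_span (idempotents (conv T) C).
Proof.
apply/seteqP; split; last first.
  by apply: lin_span_sub; [exact: steinberg_on_submodule|move=> e []].
apply: span_steinberg => x ux; exists (unit_space G), (fun x => tw_i T x 1%g).
split; first by split=> //; exact: open_unit_space.
  by apply: unit_section; exact: open_unit_space.
by move=> U cU oU UU; apply: indicator_idempotent => // y /UU[].
Qed.

(** At a unit, convolution in the diagonal is the product of values. *)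
Lemma idempotent_01 e u : indecomposable R -> idempotents (conv T) C e ->
  unit_space Sigma u -> e u = 0 \/ e u = 1.
Proof.
move=> indR [Ce ee] uu; apply: indR.
have [[_ eqe _] _] := Ce.
by rewrite -{3}ee conv_diag_l // rng_unit.
Qed.

Lemma diag_without_torsion : indecomposable R -> without_torsion (conv T) C.
Proof.
move=> indR e t Ie e0 te; have [Ce _] := Ie.
have [s es] : exists s, e s != 0.
  apply: contrapT => /forallNP es; apply: e0; apply/funext => s.
  by apply/eqP/negPn/negP; exact: es.
have [_ ers] := diag_rng Ce es.
have [er|er] := idempotent_01 indR Ie (unit_rng s); first by rewrite er eqxx in ers.
have := congr1 (fun f => f (rng s)) te; rewrite /GRing.scale /= er.
by rewrite /GRing.scale /= mulr1.
Qed.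

Definition expectation f : Sigma -> R^o := cutoff T (unit_space G) f.

Lemma expectation_diag f : A f -> C (expectation f).
Proof.
move=> Af; split; last by rewrite suppG_cutoff => x [].
by apply: steinberg_cutoff => //; exact: clopen_unit_space.
Qed.

Lemma expectation_id c : C c -> expectation c = c.
Proof.
move=> [[_ ec _] cU]; apply/funext => s.
have [us|nus] := pselect (unit_space G (q s)); first exact: cutoff_in.
by rewrite /expectation cutoff_out // (suppG_qN ec) // => /cU.
Qed.

Lemma expectation_unit f u : unit_space Sigma u -> expectation f u = f u.
Proof. by move=> uu; apply: cutoff_in; exact: q_unit. Qed.

Lemma expectation_conditional (X : set (Sigma -> R^o)) : X `<=` A ->
  conditional_expectation (conv T) X C expectation.
Proof.
move=> XA; split.
- by move=> f /XA; exact: expectation_diag.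
- move=> t f g _ _; apply/funext => s; rewrite addscaleE /expectation /cutoff.
  by case: ifP => // _; rewrite mulr0 addr0.
- exact: expectation_id.
- move=> c f d Cc /XA Af Cd; have [_ ef _] := Af.
  have [[_ eE _] _] := expectation_diag Af.
  have [Ac _] := Cc.
  have ecf := conv_equivariant G_ample Ac ef.
  have ecE := conv_equivariant G_ample Ac eE.
  apply/funext => s; rewrite conv_diag_r // conv_diag_l //.
  rewrite /expectation /cutoff; case: ifP => _.
    by rewrite conv_diag_r // conv_diag_l.
  by rewrite mulr0 mul0r.
Qed.

End DiagonalSubalgebra.

(** * Normalisers supported on bisections, and the three kinds of pairs *)

Section UnitBisections.
Variables (R : comUnitRingType) (G Sigma : topGroupoid) (T : twist R G Sigma).
Hypotheses (G_ample : ample G) (G_haus : hausdorff_space G).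
Local Notation q := (tw_q T).
Local Notation act := (tw_act T).
Implicit Types (a b s u : Sigma) (t : units R) (x y : G).
Implicit Types (c e f g h : Sigma -> R^o).
Local Notation "f ** g" := (conv T f g) (at level 40, left associativity).
Local Notation A := (steinberg T).
Local Notation C := (steinberg_diag T).

Definition unit_bisection f : Prop :=
  [/\ A f, rng_injective (suppG T f), src_injective (suppG T f) &
      forall s, f s != 0 -> (f s : R) \is a GRing.unit].

(** Inverting an arrow inverts the unit by which equivariance scales the value,
    and inverting the value undoes this; the result is therefore equivariant as
    soon as the nonzero values of [f] are units. *)
Definition dagger f : Sigma -> R^o := fun s => (f (ginv s) : R)^-1.

Lemma unit_bisection_chi (B U : set G) P : open_bisection B -> U `<=` B ->
  open U -> compact U -> section_on T U P -> unit_bisection (chi T U P).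
Proof.
move=> bB UB oU cU secP; split.
- by apply: steinberg_chi => //; exact: compact_closed.
- by rewrite suppG_chi => x y /UB Bx /UB By; exact: (bisection_rng_inj bB).
- by rewrite suppG_chi => x y /UB Bx /UB By; exact: (bisection_src_inj bB).
- move=> s cs; apply: chi_unit.
  by have : suppG T (chi T U P) (q s); [exists s|rewrite suppG_chi].
Qed.

Lemma suppG_dagger f x : suppG T (dagger f) x <-> suppG T f (ginv x).
Proof.
split=> [[s fs <-]|[s fs sx]].
  by exists (ginv s); rewrite ?q_inv //; move: fs; rewrite /supp /= invr_eq0.
exists (ginv s); last by rewrite q_inv sx ginvK.
by rewrite /supp /= /dagger invr_eq0 ginvK.
Qed.

Lemma steinberg_dagger f : unit_bisection f -> A (dagger f).
Proof.
move=> [[lf ef cf] _ _ uf]; split.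
- move=> s; near=> a; congr (_^-1); near: a.
  exact: (@ginv_continuous Sigma s _ (lf (ginv s))).
- move=> t s; rewrite /dagger act_ginv ef val_unitV invrK.
  have [->|fs] := eqVneq (f (ginv s)) 0; first by rewrite mulr0 invr0 mulr0.
  by rewrite invrM ?(valP t) ?uf // mulrC.
- have -> : suppG T (dagger f) = ginv @` suppG T f.
    apply/seteqP; split=> [x /suppG_dagger fx|_ [x fx <-]].
      by exists (ginv x) => //; rewrite ginvK.
    by apply/suppG_dagger; rewrite ginvK.
  by apply: continuous_compact => //; apply: continuous_subspaceT;
    exact: ginv_continuous.
Unshelve. all: by end_near.
Qed.

Lemma dagger_rng_injective f : unit_bisection f ->
  rng_injective (suppG T (dagger f)).
Proof.
move=> [_ _ fi _] x y /suppG_dagger fx /suppG_dagger fy rxy.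
by apply: (can_inj (@ginvK G)); apply: fi; rewrite ?src_inv.
Qed.

Lemma dagger_conv_src f s : unit_bisection f -> f s != 0 ->
  (dagger f ** f) (src s) = 1.
Proof.
move=> bf fs; have [[_ ef _] _ _ uf] := bf.
have [_ ed _] := steinberg_dagger bf.
have di := dagger_rng_injective bf.
rewrite (conv_rng_injective (B := suppG T (dagger f)) (a := ginv s)) //.
- by rewrite /dagger ginvK gmul_src mulVr // uf.
- by apply/suppG_dagger; rewrite q_inv ginvK; exists s.
- by rewrite -!q_rng rng_inv rng_src.
Qed.

(** A product of an inverse of an arrow of the bisection by an arrow of the same
    bisection is a unit, namely a source. *)
Lemma dagger_conv_sub f g : unit_bisection f -> A g ->
  suppG T g `<=` suppG T f ->
  C (dagger f ** g) /\ suppG T (dagger f ** g) `<=` src @` suppG T f.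
Proof.
move=> bf Ag gf; have [Af fi _ _] := bf; have Ad := steinberg_dagger bf.
have [_ ed _] := Ad; have [_ eg _] := Ag.
have h x : suppG T (dagger f ** g) x -> exists2 y, suppG T f y & x = src y.
  move=> /(suppG_conv ed eg)[y [z [/suppG_dagger fy /gf fz cyz ->]]].
  exists z => //; suff <- : ginv y = z by rewrite src_inv gmulV.
  by apply: fi => //; rewrite rng_inv.
split; last by move=> x /h[y fy ->]; exists y.
split; first exact: steinberg_conv.
by move=> x /h[y _ ->]; exact: unit_src.
Qed.

(** The mirror image of the preceding fact, with ranges in place of sources. *)
Lemma conv_dagger_sub f g : unit_bisection f -> A g ->
  suppG T g `<=` suppG T f ->
  C (g ** dagger f) /\ suppG T (g ** dagger f) `<=` rng @` suppG T f.
Proof.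
move=> bf Ag gf; have [Af _ fi _] := bf; have Ad := steinberg_dagger bf.
have [_ ed _] := Ad; have [_ eg _] := Ag.
have h x : suppG T (g ** dagger f) x -> exists2 y, suppG T f y & x = rng y.
  move=> /(suppG_conv eg ed)[y [z [/gf fy /suppG_dagger fz cyz ->]]].
  exists y => //; suff -> : z = ginv y by [].
  by rewrite -[z]ginvK; congr ginv; apply: fi => //; rewrite src_inv.
split; last by move=> x /h[y fy ->]; exists y.
split; first exact: steinberg_conv.
by move=> x /h[y _ ->]; exact: unit_rng.
Qed.

(** The products of [f] with its inverse are 1 at the sources and at the ranges
    of the support. Conjugating [c] stays in the diagonal because multiplying by
    [c] does not enlarge supports. *)
Lemma normaliser_unit_bisection (X : set (Sigma -> R^o)) f :
  unit_bisection f -> X f -> X (dagger f) ->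
  normaliser_pair (conv T) X C f (dagger f).
Proof.
move=> bf Xf Xd; have [Af fi si uf] := bf; have Ad := steinberg_dagger bf.
have [_ ef _] := Af; have [_ ed _] := Ad.
have [Cdf _] := dagger_conv_sub bf Af (fun x fx => fx).
split=> //.
- apply/funext => s; rewrite conv_diag_l //.
  have [->|ds] := eqVneq (dagger f s) 0; first by rewrite mulr0.
  rewrite -src_inv dagger_conv_src ?mul1r //.
  by move: ds; rewrite invr_eq0.
- rewrite (convA (T := T)) //; apply/funext => s; rewrite conv_diag_r //.
  have [->|fs] := eqVneq (f s) 0; first by rewrite mul0r.
  by rewrite dagger_conv_src ?mulr1.
- move=> c Cc; have [Ac _] := Cc; split.
    rewrite (convA (T := T)) //.
    have [] // := @dagger_conv_sub f (c ** f); first exact: steinberg_conv.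
    move=> _ [s cfs <-]; exists s => //; move: cfs; rewrite /supp /= conv_diag_l //.
    by apply: contra_neq => ->; rewrite mulr0.
  have [] // := @conv_dagger_sub f (f ** c); first exact: steinberg_conv.
  move=> _ [s cfs <-]; exists s => //; move: cfs; rewrite /supp /= conv_diag_r //.
  by apply: contra_neq => ->; rewrite mul0r.
Qed.

(** [(dagger f ** f)] and [(f ** dagger f)] live on the source and the range of
    the support of [f], which are disjoint. *)
Lemma dagger_free f : unit_bisection f ->
  (forall x y, suppG T f x -> suppG T f y -> src x <> rng y) ->
  (dagger f ** f) ** (f ** dagger f) = 0.
Proof.
move=> bf disj; have [Af _ _ _] := bf.
have [Cdf dfU] := dagger_conv_sub bf Af (fun x fx => fx).
have [Cfd fdU] := conv_dagger_sub bf Af (fun x fx => fx).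
have [[_ efd _] _] := Cfd.
apply/funext => s; rewrite conv_diag_l //; apply/eqP; apply: contrapT => /negP ns.
have [x fx xs] : (src @` suppG T f) (q (rng s)).
  by apply: dfU; exists (rng s) => //; apply: contra_neq ns => ->; rewrite mul0r.
have fds : suppG T (f ** dagger f) (q s).
  by exists s => //; apply: contra_neq ns => ->; rewrite mulr0.
have [y fy ys] := fdU _ fds.
by apply: (disj x y) => //; rewrite xs q_rng -ys rng_rng.
Qed.

(** No cancellation can occur: the value of the product is a unit times a nonzero
    value. *)
Lemma suppG_conv_unit_l f g x y : unit_bisection f -> A g ->
  suppG T f x -> suppG T g y -> composable x y ->
  suppG T (f ** g) (gmul x y).
Proof.
move=> [Af fi _ uf] [_ eg _] [a fa <-] [b gb <-] /composable_q cab.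
have [_ ef _] := Af; exists (gmul a b); last exact: q_mul.
rewrite /supp /= (conv_rng_injective (B := suppG T f) (a := a)) //.
- rewrite gmulKl //; apply: contra_neq gb => fg.
  by apply: (mulrI (uf a fa)); rewrite mulr0.
- by exists a.
- by rewrite -!q_rng rng_mul.
Qed.

Lemma suppG_conv_unit_r f g x y : unit_bisection g -> A f ->
  suppG T f x -> suppG T g y -> composable x y ->
  suppG T (f ** g) (gmul x y).
Proof.
move=> [Ag _ gi ug] [_ ef _] [a fa <-] [b gb <-] /composable_q cab.
have [_ eg _] := Ag; exists (gmul a b); last exact: q_mul.
rewrite /supp /= (conv_src_injective (B := suppG T g) (a := b)) //.
- rewrite gmulKr //; apply: contra_neq fa => fg.
  by apply: (mulIr (ug b gb)); rewrite mul0r.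
- by exists b.
- by rewrite -!q_src src_mul.
Qed.

Lemma bisection_section (Y : set G) x : open Y -> Y x ->
  exists (W : set G) (P : G -> Sigma),
    [/\ open_nbhs x W, section_on T W P, open_bisection W & W `<=` Y].
Proof.
move=> oY Yx; have [B [P [bB Bx secP]]] := local_section T x.
have oB : open B by case: bB.
exists (B `&` Y), P; split.
- by split; [exact: openI|split].
- by apply: section_onS secP => y [].
- by apply: (open_bisection_sub _ _ bB); [move=> y []|exact: openI].
- by move=> y [].
Qed.

Lemma steinberg_on_span (Y : set G) (N : set (Sigma -> R^o)) :
  (forall x, Y x -> exists2 W, open_nbhs x W &
    forall f, unit_bisection f -> suppG T f `<=` W `&` Y -> N f) ->
  steinberg_on T Y `<=` lin_span N.
Proof.
move=> locN; apply: span_steinberg => // x Yx.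
have [W' [oW' W'x] NW'] := locN x Yx.
have [W [P [oW secP bW WW']]] := bisection_section oW' W'x.
exists W, P; split=> // U cU oU UW; apply: NW'.
  by apply: unit_bisection_chi bW _ _ _ _ => //;
    [move=> y /UW[]|apply: section_onS secP => y /UW[]].
by rewrite suppG_chi => y /UW[/WW'].
Qed.

End UnitBisections.

Definition open_wide_subgroupoid (G : topGroupoid) (Z : set G) : Prop :=
  [/\ open Z, unit_space G `<=` Z, forall x, Z x -> Z (ginv x) &
      forall x y, Z x -> Z y -> composable x y -> Z (gmul x y)].

Section Pairs.
Variables (R : comUnitRingType) (G Sigma : topGroupoid) (T : twist R G Sigma).
Hypotheses (G_ample : ample G) (G_haus : hausdorff_space G).
Variable Z : set G.
Hypothesis Zsub : open_wide_subgroupoid Z.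
Local Notation q := (tw_q T).
Local Notation act := (tw_act T).
Implicit Types (a b s u : Sigma) (t : units R) (x y : G).
Implicit Types (c e f g h : Sigma -> R^o).
Local Notation "f ** g" := (conv T f g) (at level 40, left associativity).
Local Notation A := (steinberg T).
Local Notation C := (steinberg_diag T).
Local Notation AZ := (steinberg_on T Z).
Local Notation E := (expectation T).

Lemma steinberg_on_algebra : is_algebra (conv T) AZ.
Proof.
have [_ _ _ ZM] := Zsub.
split.
- exact: steinberg_on_submodule.
- move=> f g [Af fZ] [Ag gZ]; split; first exact: steinberg_conv.
  have [_ ef _] := Af; have [_ eg _] := Ag.
  by move=> _ /(suppG_conv ef eg)[y [z [/fZ Zy /gZ Zz cyz ->]]]; exact: ZM.
- by move=> f g h [Af _] [Ag _] [Ah _]; exact: convA.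
- by move=> t f g h [Af _] [Ag _] [[_ eh _] _]; exact: convDZl.
- by move=> t f g h [Af _] [[_ eg _] _] [[_ eh _] _]; exact: convDZr.
Qed.

Lemma diag_sub : C `<=` AZ.
Proof. by have [_ ZU _ _] := Zsub; apply: steinberg_onS. Qed.

Lemma diag_commutative : commutative_subalgebra (conv T) AZ C.
Proof.
split; [exact: diag_sub|exact: steinberg_on_submodule| |].
- by move=> c d; exact: diagM.
- by move=> c d; exact: diagC.
Qed.

Lemma local_units_on : local_units (conv T) AZ C.
Proof.
by move=> F finF FZ; apply: local_units_steinberg => // f /FZ[].
Qed.

Lemma normaliser_on f : unit_bisection T f -> suppG T f `<=` Z ->
  normaliser_pair (conv T) AZ C f (dagger f).
Proof.
have [_ _ ZV _] := Zsub.
move=> bf fZ; have [Af _ _ _] := bf.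
apply: normaliser_unit_bisection => //; split=> //; first exact: steinberg_dagger.
by move=> x /suppG_dagger/fZ/ZV; rewrite ginvK.
Qed.

Lemma normaliser_at x : Z x -> exists f, [/\ unit_bisection T f,
  normaliser_pair (conv T) AZ C f (dagger f) & suppG T f x].
Proof.
have [oZ _ _ _] := Zsub; move=> Zx.
have [W [P [oW secP bW WZ]]] := bisection_section T oZ Zx.
have [U [cU [oU _ _ _ _] Ux] UW] := ample_nbhs G_ample oW.
have bf : unit_bisection T (chi T U P).
  by apply: unit_bisection_chi bW _ _ _ _ => //; exact: section_onS secP.
exists (chi T U P); split=> //; last by rewrite suppG_chi.
by apply: normaliser_on => //; rewrite suppG_chi; exact: subset_trans WZ.
Qed.

Lemma normalisers_span : AZ = lin_span (normalisers (conv T) AZ C).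
Proof.
apply/seteqP; split; last first.
  by apply: lin_span_sub; [exact: steinberg_on_submodule|move=> f [m [[]]]].
apply: steinberg_on_span => // x Zx.
exists Z; first by split=> //; case: Zsub.
move=> f bf fZ; exists (dagger f); apply: normaliser_on => //.
by move=> y /fZ[].
Qed.

(** A normaliser over the inverse of an arrow of the support of [f] moves that
    arrow to a unit, where the product does not vanish. *)
Lemma expectation_faithful : faithful (conv T) AZ C E.
Proof.
have [_ _ ZV _] := Zsub.
move=> f [Af fZ] f0; have [_ ef _] := Af.
have [s fs] : exists s, f s != 0.
  apply: contrapT => /forallNP h; apply: f0; apply/funext => s.
  by apply/eqP/negPn/negP; exact: h.
have Zs : Z (ginv (q s)) by apply/ZV/fZ; exists s.
have [n [bn Nn ns]] := normaliser_at Zs; exists n; first by exists (dagger n).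
have [An _ _ _] := bn.
have := suppG_conv_unit_l bn Af ns (x := ginv (q s)) (y := q s).
move=> /(_ (ex_intro2 _ _ s fs erefl) (composableVl _)).
rewrite gmulVl -q_src => nf En.
have [_ enf _] := steinberg_conv G_ample G_haus An Af.
move/suppG_q: nf => /(_ enf)/eqP; apply.
by rewrite -(expectation_unit T) ?En //; exact: unit_src.
Qed.

Lemma steinberg_pair : indecomposable R -> algebraic_pair (conv T) AZ C.
Proof.
move=> indR; split.
- by split; [exact: steinberg_on_algebra|exact: diag_commutative].
- exact: diag_without_torsion.
split; [exact: local_units_on|exact: diag_span|exact: normalisers_span|].
exists E; last exact: expectation_faithful.
by apply: expectation_conditional => // f [].
Qed.

(** An indicator that separates the range of an arrow from its source detects
    that arrow on one side only. *)
Lemma steinberg_maximal_commutative :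
  (forall O : set G, open O -> O `<=` Z -> (forall x, O x -> rng x = src x) ->
     O `<=` unit_space G) ->
  maximal_commutative (conv T) AZ C.
Proof.
move=> effZ D [DZ subD DM DC] CD; apply/seteqP; split=> // d Dd.
have [Ad dZ] := DZ d Dd; split=> //; have [ld ed _] := Ad.
have [od _] := suppG_clopen ld ed.
pose O := suppG T d `&` ~` unit_space G.
suff OU : O `<=` unit_space G.
  by move=> x dx; apply: contrapT => nx; apply: (nx); apply: OU.
apply: effZ; [|by move=> x [/dZ]|].
  by apply: openI => //; rewrite openC; case: (clopen_unit_space G_ample G_haus).
move=> x [[s ds <-] _]; apply: contrapT => nrs.
pose W : set G := unit_space G `&` ~` [set src (q s)].
have oW : open_nbhs (rng (q s)) W.
  split; last by split=> //; exact: unit_rng.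
  apply: openI; first exact: open_unit_space.
  rewrite openC; apply: accessible_closed_set1; exact: hausdorff_accessible.
have [K [cK [oK _ _ _ _] Kr] KW] := ample_nbhs G_ample oW.
have KU : K `<=` unit_space G by move=> y /KW[].
have CK := indicator_diag T G_ample G_haus KU oK cK.
have := congr1 (fun f => f s) (DC _ _ (CD _ CK) Dd).
rewrite conv_diag_l // conv_diag_r // indicator_in; last 2 first.
- exact: unit_rng.
- by rewrite q_rng.
rewrite indicator_out ?mul1r ?mulr0; first by apply/eqP.
by rewrite q_src => /KW[_]; apply.
Qed.

(** Arrows that are not units have distinct range and source, which are separated
    by disjoint open sets; a bisection between these gives a free normaliser. *)
Lemma steinberg_free_span :
  (forall x, Z x -> rng x = src x -> unit_space G x) ->
  AZ = lin_span (free_normalisers (conv T) AZ C).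
Proof.
move=> prZ; have [oZ ZU _ _] := Zsub; apply/seteqP; split; last first.
  by apply: lin_span_sub; [exact: steinberg_on_submodule|move=> f [[m [[]]]]].
apply: steinberg_on_span => // x Zx.
have [ux|nux] := pselect (unit_space G x).
  exists (unit_space G); first by split=> //; exact: open_unit_space.
  move=> f bf fU; split; first by exists (dagger f); apply: normaliser_on => // y /fU[].
  by left; split; [case: bf|move=> y /fU[]].
have nrs : src x != rng x by apply/eqP => /esym/(prZ _ Zx).
have := G_haus; rewrite open_hausdorff => /(_ _ _ nrs)[[U V]] /=.
rewrite !inE => -[Us Vr] [oU oV UV].
exists (src @^-1` U `&` rng @^-1` V).
  split=> //; apply: openI.
    by move: U oU {Us UV}; apply/continuousP; exact: src_continuous.
  by move: V oV {Vr UV}; apply/continuousP; exact: rng_continuous.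
move=> f bf fUV; have Nf : normaliser_pair (conv T) AZ C f (dagger f).
  by apply: normaliser_on => // y /fUV[].
split; first by exists (dagger f).
right; exists (dagger f) => //; apply: dagger_free => // y z /fUV[[Uy _] _].
move=> /fUV[[_ Vz] _] yz; suff : (U `&` V) (rng z) by rewrite UV.
by split=> //; rewrite -yz.
Qed.

Definition bisection_normalisers : Prop :=
  forall n, normalisers (conv T) AZ C n ->
    rng_injective (suppG T n) /\ src_injective (suppG T n).

(** The idempotent is the indicator of the units in the support of [n]: an arrow
    of the support whose source or range is such a unit must be that unit. *)
Lemma expectation_implemented : bisection_normalisers ->
  implemented_by_idempotents (conv T) AZ C E.
Proof.
move=> bisN n Nn; have [ri si] := bisN n Nn.
have An : A n by have [m [[[]]]] := Nn.
have [ln en cn] := An; have [on cln] := suppG_clopen ln en.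
pose K := suppG T n `&` unit_space G.
have [oU cU] := clopen_unit_space G_ample G_haus.
have oK : open K by exact: openI.
have cK : compact K.
  by apply: (subclosed_compact _ cn); [exact: closedI|move=> x []].
have KU : K `<=` unit_space G by move=> x [].
have CK := indicator_diag T G_ample G_haus KU oK cK.
exists (indicator T K); first exact: indicator_idempotent.
have EK s : E n s = if q s \in K then n s else 0.
  rewrite /expectation /cutoff; case: ifPn => [us|nus].
    have [ns|ns] := eqVneq (n s) 0; first by rewrite ns if_same.
    by rewrite ifT // inE; split; [exists s|rewrite inE in us].
  case: ifPn => //; rewrite inE => -[_ us].
  by move: nus; rewrite notin_setE => /(_ us).
have En : E n = n ** indicator T K.
  apply/funext => s; rewrite EK conv_diag_r //.
  have [->|ns] := eqVneq (n s) 0; first by rewrite if_same mul0r.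
  have qn : suppG T n (q s) by exists s.
  have [Ks|nKs] := pselect (K (q (src s))).
    rewrite indicator_in ?mulr1 //; last exact: unit_src.
    rewrite ifT // inE; suff -> : q s = q (src s) by [].
    by apply: si => //; [case: Ks|rewrite q_src src_src].
  rewrite indicator_out // mulr0 ifF //; apply/negbTE; rewrite notin_setE => Ks.
  by apply: nKs; rewrite q_src src_unit //; case: Ks.
split=> //; rewrite -En.
apply/funext => s; rewrite EK conv_diag_l //.
have [->|ns] := eqVneq (n s) 0; first by rewrite if_same mulr0.
have qn : suppG T n (q s) by exists s.
have [Ks|nKs] := pselect (K (q (rng s))).
  rewrite indicator_in ?mul1r //; last exact: unit_rng.
  rewrite ifT // inE; suff -> : q s = q (rng s) by [].
  by apply: ri => //; [case: Ks|rewrite q_rng rng_rng].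
rewrite indicator_out // mul0r ifF //; apply/negbTE; rewrite notin_setE => Ks.
by apply: nKs; rewrite q_rng rng_unit //; case: Ks.
Qed.

(** An idempotent [e] with [P m] equal to [m ** e] cuts the support of [m]
    down; when that support avoids the units, nothing of it is left in [C]. *)
Lemma implemented_expectation_unique P : conditional_expectation (conv T) AZ C P ->
  implemented_by_idempotents (conv T) AZ C P -> forall f, AZ f -> P f = E f.
Proof.
move=> [PC PD Pid _] Pimp f [Af fZ].
have [oZ _ _ _] := Zsub.
have [oU cU] := clopen_unit_space G_ample G_haus.
have [|_ ED _ _] := @expectation_conditional _ _ _ T G_ample G_haus AZ.
  by move=> g [].
have C0 : C 0 by have [] := steinberg_on_submodule T (unit_space G).
have AZ0 := diag_sub C0.
have PZ (t : R) g : AZ g -> P (t *: g) = t *: P g.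
  by move=> Zg; have := PD t g 0 Zg AZ0; rewrite (Pid 0 C0) !addr0.
suff [] : AZ f /\ P f = E f by [].
apply: (steinberg_ind G_ample G_haus (Q := fun f => AZ f /\ P f = E f) Af).
- by split=> //; rewrite Pid // expectation_id.
- move=> g h [Zg Pg] [Zh Ph]; split.
    by have [_ ZD _] := steinberg_on_submodule T Z; exact: ZD.
  have := PD 1 g h Zg Zh; have := ED 1 g h Zg Zh.
  by rewrite !scale1r Pg Ph => -> ->.
move=> x /fZ Zx; have [ux|nux] := pselect (unit_space G x).
  have [W [P0 [oW secP bW WU]]] := bisection_section T oU ux.
  exists W, P0; split=> // t U cpU opU UW.
  have CU : C (t *: chi T U P0).
    split; last by move=> y /suppGZ; rewrite suppG_chi => /UW[/WU].
    apply: steinbergZ; apply: steinberg_chi => //; first exact: compact_closed.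
    by apply: section_onS secP => y /UW[].
  by split; [exact: diag_sub|rewrite Pid // expectation_id].
have oY : open (Z `&` ~` unit_space G) by apply: openI => //; rewrite openC.
have [W [P0 [oW secP bW WY]]] := bisection_section T oY (conj Zx nux).
exists W, P0; split=> // t U cpU opU UW.
have bm : unit_bisection T (chi T U P0).
  by apply: unit_bisection_chi bW _ _ _ _ => //;
    [move=> y /UW[]|apply: section_onS secP => y /UW[]].
have mZ : suppG T (chi T U P0) `<=` Z.
  by rewrite suppG_chi => y /UW[/WY[]].
have Zm : AZ (chi T U P0) by case: bm.
have [_ _ ZZ] := steinberg_on_submodule T Z.
split; first exact: ZZ.
have [e [Ce _] [Pm _]] := Pimp _ (ex_intro _ _ (normaliser_on bm mZ)).
have out s : unit_space G (q s) -> chi T U P0 s = 0.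
  by move=> us; apply: cutoff_out => /UW[/WY[_]].
have Pm0 : P (chi T U P0) = 0.
  have [[_ ePm _] PmU] := PC _ Zm; have [[_ em _] _] := Zm.
  apply/funext => s; have [us|nus] := pselect (unit_space G (q s)).
    by rewrite Pm conv_diag_r // out // mul0r.
  by apply: (suppG_qN ePm) => /PmU.
rewrite PZ // Pm0 scaler0; apply/funext => s.
rewrite /expectation /cutoff; case: ifP => //; rewrite inE => us.
by rewrite /GRing.scale /= out // scaler0.
Qed.

(** Two arrows [x] and [y] of the support with equal ranges are translated by
    the inverse of [x] into a unit and an arrow with the same range; for
    equal sources the translation is on the right. *)
Lemma implemented_bisection_normalisers : indecomposable R ->
  implemented_by_idempotents (conv T) AZ C E -> bisection_normalisers.
Proof.
move=> indR Eimp.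
have [_ _ ZV _] := Zsub.
(* a unit in the support of n is the only point there with its source, or with
   its range: the idempotent that implements E at n is 1 on it *)
have key n y : normalisers (conv T) AZ C n -> unit_space G y -> suppG T n y ->
    forall x, suppG T n x -> src x = y \/ rng x = y -> x = y.
  move=> Nn uy [s ns sy] x [a na ax] xy.
  have An : A n by have [m [[[]]]] := Nn.
  have [_ en _] := An.
  have [e Ie [En ne]] := Eimp n Nn; have [Ce _] := Ie.
  pose u := rng s; have uu : unit_space Sigma u := unit_rng s.
  have qu : q u = y by rewrite q_rng sy rng_unit.
  have nu : n u != 0.
    by apply/(suppG_q (T := T)) => //; rewrite qu -sy; exists s.
  have eu : e u = 1.
    have [e0|//] := idempotent_01 indR Ie uu.
    have := congr1 (fun f => f u) En; rewrite expectation_unit // conv_diag_r //.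
    by rewrite src_unit // e0 mulr0 => /eqP; rewrite (negbTE nu).
  have Ena : E n a != 0.
    case: xy => xy.
      have sa : src a = u.
        by apply: (q_unit_inj (T := T)) => //;
          [exact: unit_src|rewrite q_src ax xy].
      by rewrite En conv_diag_r // sa eu mulr1.
    have ra : rng a = u.
      by apply: (q_unit_inj (T := T)) => //;
        [exact: unit_rng|rewrite q_rng ax xy].
    by rewrite En ne conv_diag_l // ra eu mul1r.
  have ux : unit_space G x.
    apply: contrapT => nux; move: Ena; rewrite /expectation cutoff_out ?eqxx //.
    by rewrite ax.
  by case: xy => <-; [rewrite src_unit|rewrite rng_unit].
move=> n Nn; have [m Nnm] := Nn; have [[[An nZ] _] _ _ _] := Nnm.
have mulN := normalisersM steinberg_on_algebra diag_commutative local_units_on.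
split=> x y nx ny xy.
  have Zx : Z (ginv x) by exact/ZV/nZ.
  have [f [bf Nf fx]] := normaliser_at Zx.
  have cxy : composable (ginv x) y by rewrite /composable src_inv.
  have Nfn : normalisers (conv T) AZ C (f ** n).
    by exists (m ** dagger f); exact: mulN.
  have e : gmul (ginv x) y = src x.
    apply: (key (f ** n)) => //.
    - exact: unit_src.
    - by rewrite -gmulVl; apply: suppG_conv_unit_l => //; exact: composableVl.
    - exact: suppG_conv_unit_l.
    - by right; rewrite rng_mul ?rng_inv.
  by rewrite -[RHS](gmulVKl xy) e gmul_src.
have Zx : Z (ginv x) by exact/ZV/nZ.
have [f [bf Nf fx]] := normaliser_at Zx.
have cyx : composable y (ginv x) by rewrite /composable rng_inv.
have Nnf : normalisers (conv T) AZ C (n ** f).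
  by exists (dagger f ** m); exact: mulN.
have e : gmul y (ginv x) = rng x.
  apply: (key (n ** f)) => //.
  - exact: unit_rng.
  - by rewrite -gmulV; apply: suppG_conv_unit_r => //; exact: composableV.
  - exact: suppG_conv_unit_r.
  - by left; rewrite src_mul ?src_inv.
by rewrite -[RHS](gmulVKr (esym xy)) e gmul_rng.
Qed.

End Pairs.

(** * The kernel of the grading and its twist *)

(** An initial map identifies the open sets of its domain with traces of open
    sets, so it reflects compactness of sets inside its range. *)
Lemma compact_initial_preimage (X' X : topologicalType) (phi : X' -> X)
    (K : set X) : initial_map phi -> K `<=` range phi -> compact K ->
  compact (phi @^-1` K).
Proof.
move=> iphi Kphi cK F FF FK.
have [x [Kx Fx]] := cK (phi @ F) _ FK.
have [x' _ ex] := Kphi x Kx; exists x'; split; first by rewrite /= /preimage /= ex.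
move=> A B FA; rewrite nbhsE => -[B' [oB' B'x] B'B].
have [V oV VB] := (iphi B').1 oB'.
have Vx : V x by rewrite -ex; move: B'x; rewrite -VB.
have FphiA : F (phi @^-1` (phi @` A)).
  by apply: filterS FA => a Aa /=; exists a.
have [_ [[a Aa <-] Vy]] := Fx _ _ FphiA (open_nbhs_nbhs (conj oV Vx)).
by exists a; split=> //; apply: B'B; rewrite -VB.
Qed.

Section KernelTwist.
Variables (R : comUnitRingType) (Gamma : groupType) (G Sigma : topGroupoid).
Variable T : gradedTwist R Gamma G Sigma.
Hypotheses (G_ample : ample G) (G_haus : hausdorff_space G).

Local Notation q := (tw_q T).
Local Notation Z := (ker (gt_G T)).
Local Notation Ge := (eps_groupoid (gt_G T)).
Local Notation Se := (eps_groupoid (gt_Sigma T)).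
Local Notation Te := (eps_twist T).
Local Notation AZ := (steinberg_on T Z).
Local Notation C := (steinberg_diag T).

Lemma open_grading (H : topGroupoid) (c : grading Gamma H) (D : set Gamma) :
  open (c @^-1` D).
Proof.
have [h _] := continuousP (c : H -> discrete_topology Gamma).
exact: (h (@grading_continuous _ _ c) _ (discrete_open _)).
Qed.

Lemma closed_ker (H : topGroupoid) (c : grading Gamma H) : closed (ker c).
Proof. by rewrite -openC; exact: (open_grading c (~` [set 1%g])). Qed.

Lemma unit_grading (H : topGroupoid) (c : grading Gamma H) (x : H) :
  unit_space H x -> c x = 1%g.
Proof. by move=> /rng_unit <-; exact: grading_rng. Qed.

Lemma ker_subgroupoid : open_wide_subgroupoid Z.
Proof.
split; first exact: open_ker.
- by move=> x; exact: unit_grading.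
- by move=> x /= Zx; rewrite /ker /= gradingV Zx invg1.
- by move=> x y /= Zx Zy cxy; rewrite /ker /= gradingM // Zx Zy mulg1.
Qed.

Lemma ker_lift (H : topGroupoid) (c : grading Gamma H) (x : H) :
  ker c x -> exists x' : eps_groupoid c, val x' = x.
Proof. by move=> Zx; have xc : x \in ker c by [rewrite inE]; exists (ker_elt xc). Qed.

Lemma val_eps_inv (H : topGroupoid) (c : grading Gamma H)
  (x : eps_groupoid c) : val (ginv x) = ginv (val x).
Proof. exact: val_ker_inv. Qed.

Lemma val_eps_act (t : units R) (s : Se) :
  val (tw_act Te t s) = tw_act T t (val s).
Proof.
have cs := (eps_composable _ _).1 (act_composable Te t s).
rewrite /tw_act val_eps_mul // val_eps_i /= ?val_ker_rng //.
by apply/eps_unit => /=; rewrite val_ker_rng; exact/q_unit/unit_rng.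
Qed.

Lemma ker_q (s : Sigma) : ker (gt_Sigma T) s <-> Z (q s).
Proof. by rewrite /ker /= gt_compat. Qed.

Definition restrict_ker (f : Sigma -> R^o) : Se -> R^o := fun s => f (val s).

Definition extend_ker (n : Se -> R^o) : Sigma -> R^o :=
  fun s => if (insub s : option Se) is Some s' then n s' else 0.

Lemma extend_ker_val n (s : Se) : extend_ker n (val s) = n s.
Proof. by rewrite /extend_ker valK. Qed.

Lemma extend_ker_out n s : ~ ker (gt_Sigma T) s -> extend_ker n s = 0.
Proof. by move=> ns; rewrite /extend_ker insubN // notin_setE. Qed.

Lemma extend_kerK n : restrict_ker (extend_ker n) = n.
Proof. by apply/funext => s; exact: extend_ker_val. Qed.

Lemma restrict_ker_inj f g : AZ f -> AZ g ->
  restrict_ker f = restrict_ker g -> f = g.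
Proof.
move=> [[_ ef _] fZ] [[_ eg _] gZ] fg; apply/funext => s.
have [Zs|nZs] := pselect (Z (q s)); last first.
  by rewrite (suppG_qN ef) ?(suppG_qN eg) // => [/gZ|/fZ].
have [s' <-] := ker_lift ((ker_q s).2 Zs).
exact: (congr1 (fun h : Se -> R^o => h s') fg).
Qed.

Lemma suppG_restrict f : suppG Te (restrict_ker f) =
  (fun x : Ge => val x) @^-1` suppG T f.
Proof.
apply/seteqP; split=> [_ [s fs <-]|x [s fs sx]]; first by exists (val s).
have [|s' es'] := @ker_lift _ (gt_Sigma T) s.
  by apply/ker_q; rewrite sx; exact: kerP.
exists s'; first by rewrite /supp /= /restrict_ker es'.
by apply: val_inj; rewrite /= es'.
Qed.

Lemma steinberg_restrict f : AZ f -> steinberg Te (restrict_ker f).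
Proof.
move=> [[lf ef cf] fZ]; split.
- move=> s; have := @val_eps_continuous _ _ (gt_Sigma T) s _ (lf (val s)).
  exact.
- by move=> t s; rewrite /restrict_ker val_eps_act ef.
- rewrite suppG_restrict; apply: compact_initial_preimage cf.
    exact: eps_initial.
  by move=> x /fZ/ker_lift[x' <-]; exists x'.
Qed.

(** The kernel is clopen, so extension by zero is still locally constant. *)
Lemma steinberg_extend n : steinberg Te n -> AZ (extend_ker n).
Proof.
move=> [ln en cn].
have suppE : suppG T (extend_ker n) = (fun x : Ge => val x) @` suppG Te n.
  apply/seteqP; split=> [_ [s ns <-]|_ [_ [s ns <-] <-]].
    have [|s' es'] := @ker_lift _ (gt_Sigma T) s.
      by apply: contrapT => ks; move: ns; rewrite /supp /= extend_ker_out ?eqxx.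
    by exists (tw_q Te s') => /=; [exists s'|rewrite es'];
      rewrite // /supp /= -extend_ker_val es'.
  by exists (val s) => //; rewrite /supp /= extend_ker_val.
split; last by rewrite suppE => _ [x _ <-]; exact: kerP.
split.
- move=> s; have [ks|nks] := pselect (ker (gt_Sigma T) s).
    have [s' es'] := ker_lift ks.
    have : nbhs s' [set b | n b = n s'] := ln s'; rewrite nbhsE => -[U [oU Us'] Un].
    have [V oV VU] := (@eps_initial _ _ (gt_Sigma T) U).1 oU.
    have oVk : open_nbhs s (V `&` ker (gt_Sigma T)).
      split; first by apply: openI => //; exact: open_ker.
      by split=> //; rewrite -es'; move: Us'; rewrite -VU.
    apply: filterS (open_nbhs_nbhs oVk) => b [Vb /ker_lift[b' eb]].
    rewrite -eb -es' !extend_ker_val; apply: Un; rewrite -VU /=.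
    by rewrite /preimage /= eb.
  have on : open_nbhs s (~` ker (gt_Sigma T)).
    by split=> //; rewrite openC; exact: closed_ker.
  by apply: filterS (open_nbhs_nbhs on) => b nb; rewrite !extend_ker_out.
- move=> t s; have [ks|nks] := pselect (ker (gt_Sigma T) s).
    by have [s' <-] := ker_lift ks; rewrite -val_eps_act !extend_ker_val en.
  rewrite !extend_ker_out ?mulr0 //.
  by move=> /ker_q; rewrite q_act => /ker_q.
- rewrite suppE; apply: continuous_compact => //.
  by apply: continuous_subspaceT; exact: val_eps_continuous.
Qed.

(** A function supported on the kernel only sees the arrows of the kernel in a
    convolution, so the two sums have the same terms. *)
Lemma conv_restrict f g : AZ f -> AZ g ->
  conv Te (restrict_ker f) (restrict_ker g) = restrict_ker (conv T f g).
Proof.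
move=> Zf Zg; have [[_ ef _] fZ] := Zf; have [[_ eg _] _] := Zg.
have [_ ef' _] := steinberg_restrict Zf.
have [_ eg' _] := steinberg_restrict Zg.
have [S qS] := global_section Te; have [S0 qS0] := global_section T.
apply/funext => s; rewrite (convE (K := setT) (S := S)) // setTI.
pose S' y : Sigma := if (insub y : option Ge) is Some y' then val (S y') else S0 y.
have S'E (y : Ge) : S' (val y) = val (S y) by rewrite /S' valK.
rewrite [RHS](convE (K := Z) (S := S')) //; last first.
  move=> y _; have [Zy|nZy] := pselect (Z y).
    have [y' <-] := ker_lift Zy; rewrite S'E.
    by rewrite -[in RHS](qS y').
  by rewrite /S' insubN ?qS0 // notin_setE.
rewrite [RHS](reindex_fsbig (fun x : Ge => val x)
  [set x : Ge | rng x = rng (tw_q Te s)]).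
  apply: eq_fsbigr => x; rewrite inE /= => rx.
  rewrite /restrict_ker S'E val_eps_mul ?val_eps_inv //.
  rewrite -val_eps_inv; apply/eps_composable.
  by rewrite /composable src_inv; apply: (rng_eq_q (T := Te)); rewrite qS.
split.
- move=> x rx; split; first exact: kerP.
  have : val (rng x) = val (rng (tw_q Te s)) by rewrite rx.
  by rewrite !val_eps_rng.
- by move=> x y _ _; exact: val_inj.
- move=> y [/ker_lift[x <-] /= rx]; exists x => //=.
  by apply: val_inj; rewrite !val_eps_rng.
Qed.

Lemma diag_restrict c : AZ c -> C c <-> steinberg_diag Te (restrict_ker c).
Proof.
move=> Zc; have [Ac cZ] := Zc; split=> [[_ cU]|[_ cU]]; split=> //.
- exact: steinberg_restrict.
- by rewrite suppG_restrict => x /cU ux; apply/eps_unit.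
- move=> x cx; have [x' ex] := ker_lift (cZ x cx); rewrite -ex.
  by apply/eps_unit/cU; rewrite suppG_restrict /= /preimage /= ex.
Qed.

(** Restriction is an injective homomorphism onto the algebra of the restricted
    twist, and it matches the two diagonals. *)
Lemma normaliser_restrict n m : AZ n -> AZ m ->
  normaliser_pair (conv T) AZ C n m <->
  normaliser_pair (conv Te) (steinberg Te) (steinberg_diag Te)
    (restrict_ker n) (restrict_ker m).
Proof.
move=> Zn Zm; have [_ ZM _ _ _] := steinberg_on_algebra T G_ample G_haus ker_subgroupoid.
have CZ := @diag_sub _ _ _ T _ ker_subgroupoid.
have ZM3 f g h : AZ f -> AZ g -> AZ h -> AZ (conv T (conv T f g) h).
  by move=> Zf Zg Zh; exact: ZM _ _ (ZM _ _ Zf Zg) Zh.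
have mulR f g h : AZ f -> AZ g -> AZ h ->
    conv Te (conv Te (restrict_ker f) (restrict_ker g)) (restrict_ker h) =
    restrict_ker (conv T (conv T f g) h).
  by move=> Zf Zg Zh; rewrite !conv_restrict //; exact: ZM.
split=> [[_ mnm nmn CC]|[_ mnm nmn CC]].
- split; [by split; exact: steinberg_restrict|by rewrite mulR // mnm|
    by rewrite mulR // nmn|].
  move=> c Cc; have Zc : AZ (extend_ker c) by apply: steinberg_extend; case: Cc.
  have Cc' : C (extend_ker c) by apply/diag_restrict; rewrite ?extend_kerK.
  rewrite -(extend_kerK c) !mulR //; have [C1 C2] := CC _ Cc'.
  by split; apply/diag_restrict => //; exact: CZ.
- split; [by []| | |].
  + apply: restrict_ker_inj => //; first exact: ZM3.
    by rewrite -mulR.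
  + apply: restrict_ker_inj => //; first exact: ZM3.
    by rewrite -mulR.
  + move=> c Cc; have Zc := CZ c Cc.
    have [C1 C2] := CC _ ((diag_restrict Zc).1 Cc).
    by split; (apply/diag_restrict; first exact: ZM3); rewrite -mulR.
Qed.

Lemma local_bisection_ker : local_bisection_hypothesis Te <->
  bisection_normalisers T Z.
Proof.
split=> [LBH n [m Nnm]|BN n [m Nnm]].
- have [[Zn Zm] _ _ _] := Nnm; have [_ nZ] := Zn.
  have bn : open_bisection (suppG Te (restrict_ker n)).
    by apply: LBH; exists (restrict_ker m); exact/normaliser_restrict.
  split=> x y nx ny xy; have [x' ex] := ker_lift (nZ x nx);
    have [y' ey] := ker_lift (nZ y ny); rewrite -ex -ey; congr val.
  + apply: (bisection_rng_inj bn); rewrite ?suppG_restrict /preimage /= ?ex ?ey //.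
    by apply: val_inj; rewrite !val_eps_rng ex ey.
  + apply: (bisection_src_inj bn); rewrite ?suppG_restrict /preimage /= ?ex ?ey //.
    by apply: val_inj; rewrite !val_eps_src ex ey.
- have [[An Am] _ _ _] := Nnm.
  have Zn := steinberg_extend An; have Zm := steinberg_extend Am.
  have [[ln en _] nZ] := Zn; have [on _] := suppG_clopen ln en.
  have [|ri si] := BN (extend_ker n).
    exists (extend_ker m); apply/normaliser_restrict => //.
    by rewrite !extend_kerK.
  rewrite -(extend_kerK n) suppG_restrict; apply: eps_open_bisection => //.
  apply: injective_open_bisection => // x y; rewrite !inE; [exact: ri|exact: si].
Qed.

(** The kernel carries the subspace topology and is open, so effectiveness can be
    tested in the ambient groupoid. *)
Lemma effective_ker : effective Ge -> forall O : set G, open O -> O `<=` Z ->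
  (forall x, O x -> rng x = src x) -> O `<=` unit_space G.
Proof.
move=> effG O oO OZ iO x Ox; have [x' ex] := ker_lift (OZ x Ox).
rewrite -ex; apply/eps_unit; rewrite -effG /interior /= nbhsE.
exists ((fun x : Ge => val x) @^-1` O).
  by split; [apply: initial_map_open => //; exact: eps_initial|rewrite /preimage /= ex].
by move=> y /= /iO ry; apply: val_inj; rewrite val_eps_rng val_eps_src.
Qed.

Lemma principal_ker : principal Ge ->
  forall x, Z x -> rng x = src x -> unit_space G x.
Proof.
move=> prG x /ker_lift[x' <-] rx; apply/eps_unit; rewrite -prG.
by apply: val_inj; rewrite val_eps_rng val_eps_src.
Qed.

End KernelTwist.

Section GradedSteinberg.
Variables (R : comUnitRingType) (Gamma : groupType) (G Sigma : topGroupoid).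
Variables (T : twist R G Sigma) (c : grading Gamma G).
Hypotheses (G_ample : ample G) (G_haus : hausdorff_space G).
Local Notation A := (steinberg T).
Local Notation A_ := (steinberg_comp T c).
Local Notation C := (steinberg_diag T).

Lemma steinberg_onT : steinberg_on T setT = A.
Proof. by apply/seteqP; split=> f; [case|split]. Qed.

Lemma whole_subgroupoid : open_wide_subgroupoid [set: G].
Proof. by split=> //; exact: openT. Qed.

(** The fibres of the grading are open, so the bisections can be chosen inside
    them. *)
Lemma homogeneous_span : A = lin_span (homogeneous_normalisers (conv T) A A_ C).
Proof.
have subA := steinberg_on_submodule T [set: G]; rewrite steinberg_onT in subA.
apply/seteqP; split; last first.
  by apply: lin_span_sub => // f [g _ [_ []]].
rewrite -[X in X `<=` _]steinberg_onT.
apply: (steinberg_on_span G_ample G_haus) => // x _.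
exists (c @^-1` [set c x]); first by split=> //; exact: open_grading.
move=> f bf fW; exists (c x) => //; split; last first.
  by split; [case: bf|move=> y /fW[]].
exists (dagger f); rewrite -[X in normaliser_pair _ X]steinberg_onT.
by apply: (@normaliser_on _ _ _ T G_ample G_haus [set: G] whole_subgroupoid).
Qed.

(** Components of distinct degrees have disjoint supports. *)
Lemma graded_steinberg : graded_algebra (conv T) A A_.
Proof.
have algA := steinberg_on_algebra T G_ample G_haus whole_subgroupoid.
rewrite steinberg_onT in algA; have [subA AM _ _ _] := algA.
split.
- split=> // g; split; first exact: (steinberg_on_submodule T (c @^-1` [set g])).
  by move=> f [].
- apply/seteqP; split; last by apply: lin_span_sub => // f [g _ []].
  rewrite {1}homogeneous_span; apply: lin_spanS => f [g _ [_ fg]].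
  by exists g.
- move=> s a us ag sum0 g gs; apply/funext => sigma.
  have [_ eg _] : A (a g) by case: (ag g).
  have [cg|ncg] := pselect (c (tw_q T sigma) = g); last first.
    by apply: (suppG_qN eg) => /(ag g).2.
  have := congr1 (fun f : Sigma -> R^o => f sigma) sum0.
  rewrite fct_sumE (bigD1_seq g) //= big1 ?addr0 // => h hg.
  have [[_ eh _] hc] := ag h; apply: (suppG_qN eh) => /hc /= ch.
  by rewrite -cg -ch eqxx in hg.
- move=> g h f1 f2 [A1 c1] [A2 c2]; split; first exact: AM.
  have [_ e1 _] := A1; have [_ e2 _] := A2.
  move=> _ /(suppG_conv e1 e2)[y [z [/c1 /= cy /c2 /= cz cyz ->]]].
  by rewrite /= gradingM // cy cz.
Qed.

End GradedSteinberg.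

(** * Graded pairs of a graded twist *)

Theorem corollary4p5 (R : comUnitRingType) (Gamma : groupType)
    (G Sigma : topGroupoid) (T : gradedTwist R Gamma G Sigma)
    (R_indecomposable : indecomposable R)
    (G_ample : ample G) (G_hausdorff : hausdorff_space G) :
  let A := steinberg T in
  let A_ := steinberg_comp T (gt_G T) in
  let C := steinberg_diag T in
  let G_eps := eps_groupoid (gt_G T) in
  [/\ effective G_eps -> graded_algebraic_Cartan_pair (conv T) A A_ C,
      principal G_eps -> graded_algebraic_diagonal_pair (conv T) A A_ C &
      graded_algebraic_quasi_Cartan_pair (conv T) A A_ C <->
        local_bisection_hypothesis (eps_twist T)].
Proof.
move=> A A_ C Ge; have kerZ := ker_subgroupoid T.
have pairZ := steinberg_pair T G_ample G_hausdorff kerZ R_indecomposable.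
have graded (pair : set (Sigma -> R^o) -> set (Sigma -> R^o) -> Prop) :
    pair (A_ 1%g) C -> graded_pair (conv T) pair A A_ C.
  move=> pairA; split=> //; first exact: graded_steinberg.
    exact: (diag_commutative T G_ample G_hausdorff kerZ).
  exact: homogeneous_span.
split.
- move=> effG; apply: graded; split; first exact: pairZ.
  apply: (steinberg_maximal_commutative G_ample G_hausdorff).
  exact: effective_ker.
- move=> prG; apply: graded; split; first exact: pairZ.
  apply: (steinberg_free_span T G_ample G_hausdorff kerZ).
  exact: principal_ker.
- split=> [[_ _ [_ [P [Pce Pf Pimp]]] _]|LBH].
    apply/local_bisection_ker => //.
    apply: (implemented_bisection_normalisers G_ample G_hausdorff kerZ) => //.
    move=> n Nn; have Zn : steinberg_on T (ker (gt_G T)) n.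
      by have [m [[]]] := Nn.
    rewrite -(implemented_expectation_unique G_ample G_hausdorff kerZ Pce Pimp Zn).
    exact: Pimp.
  apply: graded; split; first exact: pairZ.
  exists (expectation T); split.
  + by apply: expectation_conditional => // f [].
  + exact: expectation_faithful.
  + by apply: expectation_implemented => //; exact/local_bisection_ker.
Qed.
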